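(* Let $X$ be a finite psyquandle, let $R$ be a commutative ring with identity, and let $\beta=(A,B,P,S)$ be a psyquandle bracket on $X$ with values in $R$. For an oriented diagram $D$ with classical crossings and pass-through-oriented 4-valent vertices, let $\Phi_X^{\beta}(D)$ be the multiset of the values $\beta(D_f)\in R$, where $f$ runs over all $X$-colorings of $D$ and $D_f$ is $D$ equipped with $f$. Then: (1) $\Phi_X^{\beta}$ is an invariant of oriented singular knots and links up to singular isotopy: if two such diagrams $D,D'$ are related by a finite sequence of planar isotopies and singular Reidemeister moves, then $\Phi_X^{\beta}(D)=\Phi_X^{\beta}(D')$ as multisets. (2) If moreover both $X$ and $\beta$ are pI-adequate, then $\Phi_X^{\beta}$ is an invariant of oriented pseudoknots and pseudolinks: if two such diagrams $D,D'$ are related by a finite sequence of planar isotopies and pseudoknot Reidemeister moves, then $\Phi_X^{\beta}(D)=\Phi_X^{\beta}(D')$ as multisets.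
   Context: **Psyquandles.** A psyquandle is a set $X$ with four binary operations $\underline{\triangleright},\overline{\triangleright},\underline{\bullet},\overline{\bullet}$ such that: (0) All four operations are right-invertible: for each operation $*$ there is an operation $*^{-1}$ with $(x*y)*^{-1}y=x=(x*^{-1}y)*y$ for all $x,y\in X$. (i) $x\,\underline{\triangleright}\,x=x\,\overline{\triangleright}\,x$ for all $x\in X$. (ii) The maps $X\times X\to X\times X$ given by $(x,y)\mapsto(y\,\overline{\triangleright}\,x,\ x\,\underline{\triangleright}\,y)$ and $(x,y)\mapsto(y\,\overline{\bullet}\,x,\ x\,\underline{\bullet}\,y)$ are bijective. (iii) For all $x,y,z\in X$ the exchange laws hold: $$\begin{array}{rcl} (x\,\underline{\triangleright}\,y)\,\underline{\triangleright}\,(z\,\underline{\triangleright}\,y)&=&(x\,\underline{\triangleright}\,z)\,\underline{\triangleright}\,(y\,\overline{\triangleright}\,z)\\ (x\,\overline{\triangleright}\,y)\,\underline{\triangleright}\,(z\,\overline{\triangleright}\,y)&=&(x\,\underline{\triangleright}\,z)\,\overline{\triangleright}\,(y\,\underline{\triangleright}\,z)\\ (x\,\overline{\triangleright}\,y)\,\overline{\triangleright}\,(z\,\overline{\triangleright}\,y)&=&(x\,\overline{\triangleright}\,z)\,\overline{\triangleright}\,(y\,\underline{\triangleright}\,z). \end{array}$$ (iv) For all $x,y\in X$: $$\begin{array}{rcl} x\,\underline{\bullet}\,((y\,\overline{\triangleright}\,x)\,\overline{\bullet}^{-1}x)&=&[(x\,\underline{\triangleright}\,y)\,\overline{\bullet}^{-1}y]\,\overline{\triangleright}\,[(y\,\overline{\triangleright}\,x)\,\overline{\bullet}^{-1}x]\\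 y\,\underline{\bullet}\,((x\,\underline{\triangleright}\,y)\,\overline{\bullet}^{-1}y)&=&[(y\,\overline{\triangleright}\,x)\,\overline{\bullet}^{-1}x]\,\underline{\triangleright}\,[(x\,\underline{\triangleright}\,y)\,\overline{\bullet}^{-1}y]. \end{array}$$ (v) For all $x,y,z\in X$: $$\begin{array}{rcl} (x\,\overline{\triangleright}\,y)\,\overline{\triangleright}\,(z\,\overline{\bullet}\,y)&=&(x\,\overline{\triangleright}\,z)\,\overline{\triangleright}\,(y\,\underline{\bullet}\,z)\\ (x\,\underline{\triangleright}\,y)\,\underline{\triangleright}\,(z\,\overline{\bullet}\,y)&=&(x\,\underline{\triangleright}\,z)\,\underline{\triangleright}\,(y\,\underline{\bullet}\,z)\\ (x\,\overline{\triangleright}\,y)\,\overline{\bullet}\,(z\,\overline{\triangleright}\,y)&=&(x\,\overline{\bullet}\,z)\,\overline{\triangleright}\,(y\,\underline{\triangleright}\,z)\\ (x\,\underline{\triangleright}\,y)\,\underline{\bullet}\,(z\,\underline{\triangleright}\,y)&=&(x\,\underline{\bullet}\,z)\,\underline{\triangleright}\,(y\,\overline{\triangleright}\,z)\\ (x\,\overline{\triangleright}\,y)\,\underline{\bullet}\,(z\,\overline{\triangleright}\,y)&=&(x\,\underline{\bullet}\,z)\,\overline{\triangleright}\,(y\,\underline{\triangleright}\,z)\\ (x\,\underline{\triangleright}\,y)\,\overline{\bullet}\,(z\,\underline{\triangleright}\,y)&=&(x\,\overline{\bullet}\,z)\,\underline{\triangleright}\,(y\,\overline{\triangleright}\,z).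 \end{array}$$ A psyquandle is pI-adequate if also $x\,\underline{\bullet}\,x=x\,\overline{\bullet}\,x$ for all $x\in X$. **Psyquandle brackets.** Let $X$ be a finite psyquandle and $R$ a commutative unital ring. A psyquandle bracket on $X$ with values in $R$ is a set of four maps $A,B,P,S:X\times X\to R$ (written $A_{x,y}=A(x,y)$, etc.) such that: (0) $A_{x,y}$ and $B_{x,y}$ are units of $R$ for all $x,y\in X$. (i) The elements $-A_{x,x}^2B_{x,x}^{-1}$, $x\in X$, are all equal; their common value is denoted $w$. (ii) The elements $-A_{x,y}B_{x,y}^{-1}-A_{x,y}^{-1}B_{x,y}$, $x,y\in X$, are all equal; their common value is denoted $\delta$. (iii) For all $x,y,z\in X$, writing $a=(x\,\underline{\triangleright}\,y,\ z\,\overline{\triangleright}\,y)$, $b=(y\,\overline{\triangleright}\,x,\ z\,\overline{\triangleright}\,x)$, $c=(x\,\underline{\triangleright}\,z,\ y\,\underline{\triangleright}\,z)$: $$\begin{array}{rcl} A_{x,y}A_{y,z}A_{a}&=&A_{x,z}A_{b}A_{c}\\ A_{x,y}B_{y,z}B_{a}&=&B_{x,z}B_{b}A_{c}\\ B_{x,y}A_{y,z}B_{a}&=&B_{x,z}A_{b}B_{c}\\ A_{x,y}A_{y,z}B_{a}&=&A_{x,z}B_{b}A_{c}+A_{x,z}A_{b}B_{c}+\delta A_{x,z}B_{b}B_{c}+B_{x,z}B_{b}B_{c}\\ B_{x,y}A_{y,z}A_{a}+A_{x,y}B_{y,z}A_{a}+\delta B_{x,y}B_{y,z}A_{a}+B_{x,y}B_{y,z}B_{a}&=&B_{x,z}A_{b}A_{c}.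 \end{array}$$ (iv) For all $x,y\in X$, writing $u=(x\,\underline{\triangleright}\,y)\,\overline{\bullet}^{-1}y$ and $v=(y\,\overline{\triangleright}\,x)\,\overline{\bullet}^{-1}x$: $$\begin{array}{rcl} A_{x,y}P_{y,u}&=&A_{v,u}P_{x,v}\\ A_{x,y}S_{y,u}+B_{x,y}P_{y,u}+\delta B_{x,y}S_{y,u}&=&B_{v,u}P_{x,v}+A_{v,u}S_{x,v}+\delta B_{v,u}S_{x,v}. \end{array}$$ (v) For all $x,y,z\in X$, writing $a'=(x\,\underline{\triangleright}\,y,\ z\,\overline{\bullet}\,y)$, $b'=(y\,\overline{\triangleright}\,x,\ z\,\overline{\triangleright}\,x)$, $c'=(x\,\underline{\triangleright}\,z,\ y\,\underline{\bullet}\,z)$: $$\begin{array}{rcl} A_{x,y}P_{y,z}A_{a'}&=&A_{x,z}P_{b'}A_{c'}\\ A_{x,y}S_{y,z}B_{a'}&=&B_{x,z}S_{b'}A_{c'}\\ B_{x,y}P_{y,z}B_{a'}&=&B_{x,z}P_{b'}B_{c'}\\ A_{x,y}P_{y,z}B_{a'}&=&A_{x,z}S_{b'}A_{c'}+A_{x,z}P_{b'}B_{c'}+\delta A_{x,z}S_{b'}B_{c'}+B_{x,z}S_{b'}B_{c'}\\ B_{x,y}P_{y,z}A_{a'}+A_{x,y}S_{y,z}A_{a'}+\delta B_{x,y}S_{y,z}A_{a'}+B_{x,y}S_{y,z}B_{a'}&=&B_{x,z}P_{b'}A_{c'} \end{array}$$ and, writing $a''=(x\,\underline{\bullet}\,y,\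 z\,\overline{\triangleright}\,y)$, $b''=(y\,\overline{\bullet}\,x,\ z\,\overline{\triangleright}\,x)$, $c''=(x\,\underline{\triangleright}\,z,\ y\,\underline{\triangleright}\,z)$: $$\begin{array}{rcl} P_{x,y}A_{y,z}A_{a''}&=&A_{x,z}A_{b''}P_{c''}\\ S_{x,y}A_{y,z}B_{a''}&=&B_{x,z}A_{b''}S_{c''}\\ P_{x,y}B_{y,z}B_{a''}&=&B_{x,z}B_{b''}P_{c''}\\ P_{x,y}A_{y,z}B_{a''}&=&A_{x,z}B_{b''}P_{c''}+A_{x,z}A_{b''}S_{c''}+\delta A_{x,z}B_{b''}S_{c''}+B_{x,z}B_{b''}S_{c''}\\ P_{x,y}B_{y,z}A_{a''}+S_{x,y}A_{y,z}A_{a''}+\delta S_{x,y}B_{y,z}A_{a''}+S_{x,y}B_{y,z}B_{a''}&=&B_{x,z}A_{b''}P_{c''}. \end{array}$$ The bracket is pI-adequate if in addition $\delta P_{x,x}+S_{x,x}=1$ for all $x\in X$. **Diagrams and moves.** Diagrams are oriented link diagrams in the plane with classical crossings and 4-valent vertices, where at each vertex two oriented strands pass straight through each other (pass-through orientation). Interpreting the vertices as rigid vertices (the four edges have a fixed cyclic order), the diagram represents a singular knot or link. Interpreting them as precrossings (classical crossings with unknown over/under information), it represents a pseudoknot or pseudolink. The singular Reidemeister moves, with all orientations and mirror images, are: - the classical Reidemeister moves I, II, III; - pII: if a classical crossing and a vertex are consecutive crossings of the same two strands (cobounding a bigon), their order may be interchanged, keeping the sign of the classical crossing; - pIII: a strand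 passing entirely over, or entirely under, the two strands meeting at a vertex may be moved across the vertex. Singular isotopy is the equivalence relation generated by planar isotopy and these moves. The pseudoknot Reidemeister moves are the singular Reidemeister moves together with move pI: a kink (monogon loop) whose only crossing is a vertex may be removed or introduced. **Colorings.** Semiarcs are the segments of the diagram between consecutive crossing points (classical crossings or vertices). An $X$-coloring is a labeling of the semiarcs by elements of $X$ obeying the following rules. Draw each crossing with both strands oriented upward, so it has bottom-left and bottom-right incoming semiarcs and top-left and top-right outgoing semiarcs. - Classical crossing (either sign): if, among the two left semiarcs, the one on the under-strand is labeled $x$ and the one on the over-strand is labeled $y$, then on the right the under-strand semiarc is labeled $x\,\underline{\triangleright}\,y$ and the over-strand semiarc is labeled $y\,\overline{\triangleright}\,x$. (At a positive crossing the over-strand runs from bottom-left to top-right; at a negative crossing it runs from bottom-right to top-left.) - Vertex: if the top-left semiarc is labeled $x$ and the bottom-left semiarc is labeled $y$, then the bottom-right semiarc (on the same strand as $x$) is labeled $x\,\underline{\bullet}\,y$ and the top-right semiarc (on the same strand as $y$) is labeled $y\,\overline{\bullet}\,x$. In each case $(x,y)$ is called the label pair of the crossing. **State sum.** Each classical crossing or vertex has two smoothings: the oriented smoothing (joining bottom-left to top-left and bottom-right to top-right when drawn with both strands upward) and the non-oriented smoothing (joining bottom-left to bottom-right and top-left to top-right). At a crossing with label pair $(x,y)$, the coefficients of the (oriented, non-oriented) smoothings are $(A_{x,y},B_{x,y})$ at a positive crossing, $(A_{x,y}^{-1},B_{x,y}^{-1})$ at a negative crossing, and $(P_{x,y},S_{x,y})$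 at a vertex. A Kauffman state is a choice of smoothing at every classical crossing and vertex. For an $X$-colored diagram $D_f$ with $p$ positive and $n$ negative classical crossings, $$\beta(D_f)=w^{\,n-p}\sum_{\text{Kauffman states } s}\delta^{k(s)}\prod_{c}(\text{coefficient of the smoothing of } c \text{ in } s),$$ where $c$ runs over all classical crossings and vertices and $k(s)$ is the number of closed curves (components) of the smoothed diagram $s$. *)

(* Defs.v *)
From HB Require Import structures.
From Stdlib Require Import Relation_Operators.
From mathcomp Require Import all_boot all_algebra.
From mathcomp Require Import finmap multiset.

Set Implicit Arguments.
Unset Strict Implicit.
Unset Printing Implicit Defensive.

Import GRing.Theory.

(** * Psyquandles *)

Definition right_inverse_of (X : Type) (op opV : X -> X -> X) : Prop :=
  forall x y, opV (op x y) y = x /\ op (opV x y) y = x.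

(** [ut], [ot], [ub], [ob] are the operations written with an under-triangle,
    over-triangle, under-bullet and over-bullet.  The right inverse of an
    operation is unique, so carrying the four inverses as fields is only a way
    to name them. *)
Record psyquandle (X : Type) := Psyquandle {
  ut : X -> X -> X;
  ot : X -> X -> X;
  ub : X -> X -> X;
  ob : X -> X -> X;
  utV : X -> X -> X;
  otV : X -> X -> X;
  ubV : X -> X -> X;
  obV : X -> X -> X;
  utK : right_inverse_of ut utV;
  otK : right_inverse_of ot otV;
  ubK : right_inverse_of ub ubV;
  obK : right_inverse_of ob obV;
  tri_diag : forall x, ut x x = ot x x;
  tri_bij : bijective (fun p : X * X => (ot p.2 p.1, ut p.1 p.2));
  bul_bij : bijective (fun p : X * X => (ob p.2 p.1, ub p.1 p.2));
  exchange1 : forall x y z,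
    ut (ut x y) (ut z y) = ut (ut x z) (ot y z);
  exchange2 : forall x y z,
    ut (ot x y) (ot z y) = ot (ut x z) (ut y z);
  exchange3 : forall x y z,
    ot (ot x y) (ot z y) = ot (ot x z) (ut y z);
  mixed1 : forall x y,
    ub x (obV (ot y x) x) = ot (obV (ut x y) y) (obV (ot y x) x);
  mixed2 : forall x y,
    ub y (obV (ut x y) y) = ut (obV (ot y x) x) (obV (ut x y) y);
  slide1 : forall x y z, ot (ot x y) (ob z y) = ot (ot x z) (ub y z);
  slide2 : forall x y z, ut (ut x y) (ob z y) = ut (ut x z) (ub y z);
  slide3 : forall x y z, ob (ot x y) (ot z y) = ot (ob x z) (ut y z);
  slide4 : forall x y z, ub (ut x y) (ut z y) = ut (ub x z) (ot y z);
  slide5 : forall x y z, ub (ot x y) (ot z y) = ot (ub x z) (ut y z);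
  slide6 : forall x y z, ob (ut x y) (ut z y) = ut (ob x z) (ot y z)
}.

Definition pI_adequate (X : Type) (Q : psyquandle X) : Prop :=
  forall x, ub Q x x = ob Q x x.

(** * Psyquandle brackets *)

Section Bracket.
Local Open Scope ring_scope.

(** [bAV], [bBV] are the pointwise inverses of [bA], [bB] (they witness that
    the values of [bA] and [bB] are units), [bw] and [bd] are the common values
    w and delta, and [bwV] is the inverse of w.  When X is nonempty all of
    these are determined by [bA] and [bB]; when X is empty [bw] is an
    irrelevant unit and [bd] an irrelevant element. *)
Record bracket (X : Type) (Q : psyquandle X) (R : comPzRingType) := Bracket {
  bA : X -> X -> R;
  bB : X -> X -> R;
  bP : X -> X -> R;
  bS : X -> X -> R;
  bAV : X -> X -> R;
  bBV : X -> X -> R;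
  bw : R;
  bwV : R;
  bd : R;
  bA_unit : forall x y, bA x y * bAV x y = 1;
  bB_unit : forall x y, bB x y * bBV x y = 1;
  bw_unit : bw * bwV = 1;
  bwE : forall x, - (bA x x ^+ 2 * bBV x x) = bw;
  bdE : forall x y, - (bA x y * bBV x y) - bAV x y * bB x y = bd;
  rIII1 : forall x y z,
    bA x y * bA y z * bA (ut Q x y) (ot Q z y)
    = bA x z * bA (ot Q y x) (ot Q z x) * bA (ut Q x z) (ut Q y z);
  rIII2 : forall x y z,
    bA x y * bB y z * bB (ut Q x y) (ot Q z y)
    = bB x z * bB (ot Q y x) (ot Q z x) * bA (ut Q x z) (ut Q y z);
  rIII3 : forall x y z,
    bB x y * bA y z * bB (ut Q x y) (ot Q z y)
    = bB x z * bA (ot Q y x) (ot Q z x) * bB (ut Q x z) (ut Q y z);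
  rIII4 : forall x y z,
    bA x y * bA y z * bB (ut Q x y) (ot Q z y)
    = bA x z * bB (ot Q y x) (ot Q z x) * bA (ut Q x z) (ut Q y z)
      + bA x z * bA (ot Q y x) (ot Q z x) * bB (ut Q x z) (ut Q y z)
      + bd * bA x z * bB (ot Q y x) (ot Q z x) * bB (ut Q x z) (ut Q y z)
      + bB x z * bB (ot Q y x) (ot Q z x) * bB (ut Q x z) (ut Q y z);
  rIII5 : forall x y z,
    bB x y * bA y z * bA (ut Q x y) (ot Q z y)
      + bA x y * bB y z * bA (ut Q x y) (ot Q z y)
      + bd * bB x y * bB y z * bA (ut Q x y) (ot Q z y)
      + bB x y * bB y z * bB (ut Q x y) (ot Q z y)
    = bB x z * bA (ot Q y x) (ot Q z x) * bA (ut Q x z) (ut Q y z);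
  rpII1 : forall x y,
    let u := obV Q (ut Q x y) y in let v := obV Q (ot Q y x) x in
    bA x y * bP y u = bA v u * bP x v;
  rpII2 : forall x y,
    let u := obV Q (ut Q x y) y in let v := obV Q (ot Q y x) x in
    bA x y * bS y u + bB x y * bP y u + bd * bB x y * bS y u
    = bB v u * bP x v + bA v u * bS x v + bd * bB v u * bS x v;
  rpIII1 : forall x y z,
    bA x y * bP y z * bA (ut Q x y) (ob Q z y)
    = bA x z * bP (ot Q y x) (ot Q z x) * bA (ut Q x z) (ub Q y z);
  rpIII2 : forall x y z,
    bA x y * bS y z * bB (ut Q x y) (ob Q z y)
    = bB x z * bS (ot Q y x) (ot Q z x) * bA (ut Q x z) (ub Q y z);
  rpIII3 : forall x y z,
    bB x y * bP y z * bB (ut Q x y) (ob Q z y)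
    = bB x z * bP (ot Q y x) (ot Q z x) * bB (ut Q x z) (ub Q y z);
  rpIII4 : forall x y z,
    bA x y * bP y z * bB (ut Q x y) (ob Q z y)
    = bA x z * bS (ot Q y x) (ot Q z x) * bA (ut Q x z) (ub Q y z)
      + bA x z * bP (ot Q y x) (ot Q z x) * bB (ut Q x z) (ub Q y z)
      + bd * bA x z * bS (ot Q y x) (ot Q z x) * bB (ut Q x z) (ub Q y z)
      + bB x z * bS (ot Q y x) (ot Q z x) * bB (ut Q x z) (ub Q y z);
  rpIII5 : forall x y z,
    bB x y * bP y z * bA (ut Q x y) (ob Q z y)
      + bA x y * bS y z * bA (ut Q x y) (ob Q z y)
      + bd * bB x y * bS y z * bA (ut Q x y) (ob Q z y)
      + bB x y * bS y z * bB (ut Q x y) (ob Q z y)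
    = bB x z * bP (ot Q y x) (ot Q z x) * bA (ut Q x z) (ub Q y z);
  rpIII6 : forall x y z,
    bP x y * bA y z * bA (ub Q x y) (ot Q z y)
    = bA x z * bA (ob Q y x) (ot Q z x) * bP (ut Q x z) (ut Q y z);
  rpIII7 : forall x y z,
    bS x y * bA y z * bB (ub Q x y) (ot Q z y)
    = bB x z * bA (ob Q y x) (ot Q z x) * bS (ut Q x z) (ut Q y z);
  rpIII8 : forall x y z,
    bP x y * bB y z * bB (ub Q x y) (ot Q z y)
    = bB x z * bB (ob Q y x) (ot Q z x) * bP (ut Q x z) (ut Q y z);
  rpIII9 : forall x y z,
    bP x y * bA y z * bB (ub Q x y) (ot Q z y)
    = bA x z * bB (ob Q y x) (ot Q z x) * bP (ut Q x z) (ut Q y z)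
      + bA x z * bA (ob Q y x) (ot Q z x) * bS (ut Q x z) (ut Q y z)
      + bd * bA x z * bB (ob Q y x) (ot Q z x) * bS (ut Q x z) (ut Q y z)
      + bB x z * bB (ob Q y x) (ot Q z x) * bS (ut Q x z) (ut Q y z);
  rpIII10 : forall x y z,
    bP x y * bB y z * bA (ub Q x y) (ot Q z y)
      + bS x y * bA y z * bA (ub Q x y) (ot Q z y)
      + bd * bS x y * bB y z * bA (ub Q x y) (ot Q z y)
      + bS x y * bB y z * bB (ub Q x y) (ot Q z y)
    = bB x z * bA (ob Q y x) (ot Q z x) * bP (ut Q x z) (ut Q y z)
}.

Definition pI_adequate_bracket (X : Type) (Q : psyquandle X)
    (R : comPzRingType) (beta : bracket Q R) : Prop :=
  forall x, bd beta * bP beta x x + bS beta x x = 1.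

End Bracket.

(** * Diagrams

    An oriented diagram is encoded by its plane combinatorial map.  The
    four-valent nodes are the classical crossings and the vertices.  We also
    allow two-valent nodes ("joints"), which are marked points on the strands:
    a component without crossings needs at least one, and the local moves below
    use them to name the ends of a crossingless arc.  Thus an edge is a
    semiarc, or a part of a semiarc cut out by marked points. *)

Variant ckind := Positive | Negative | Vertex.

Definition ckind_code (k : ckind) : option bool :=
  match k with Positive => Some true | Negative => Some false | Vertex => None end.
Definition ckind_decode (o : option bool) : ckind :=
  match o with Some true => Positive | Some false => Negative | None => Vertex end.
Lemma ckind_codeK : cancel ckind_code ckind_decode. Proof. by case. Qed.
HB.instance Definition _ := Equality.copy ckind (can_type ckind_codeK).

Definition signed (b : bool) : ckind := if b then Positive else Negative.

(** A four-valent node drawn with both strands upward: the incoming edges are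
    bottom-left and bottom-right, the outgoing ones top-left and top-right, and
    the two strands run from [bl] to [tr] and from [br] to [tl]. *)
Record crossing (E : Type) := Crossing {
  kind : ckind;
  bl : E;
  br : E;
  tl : E;
  tr : E
}.

Definition crossing_code (E : Type) (c : crossing E) :=
  (kind c, (bl c, br c), (tl c, tr c)).
Definition crossing_decode (E : Type) (t : ckind * (E * E) * (E * E)) :=
  Crossing t.1.1 t.1.2.1 t.1.2.2 t.2.1 t.2.2.
Lemma crossing_codeK (E : Type) :
  cancel (@crossing_code E) (@crossing_decode E).
Proof. by case. Qed.
HB.instance Definition _ (E : eqType) :=
  Equality.copy (crossing E) (can_type (@crossing_codeK E)).

(** [f] relabels the incoming edges and [g] the outgoing ones. *)
Definition map_crossing (E E' : Type) (f g : E -> E') (c : crossing E) :=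
  Crossing (kind c) (f (bl c)) (f (br c)) (g (tl c)) (g (tr c)).

(** A joint [(a, b)] has incoming edge [a] and outgoing edge [b].  A [piece] is
    any collection of nodes; it may have loose ends. *)
Record piece := Piece {
  edge : finType;
  crossings : seq (crossing edge);
  joints : seq (edge * edge)
}.

Definition incoming (D : piece) : seq (edge D) :=
  flatten [seq [:: bl c; br c] | c <- crossings D] ++ unzip1 (joints D).
Definition outgoing (D : piece) : seq (edge D) :=
  flatten [seq [:: tl c; tr c] | c <- crossings D] ++ unzip2 (joints D).

Definition closed_piece (D : piece) : bool :=
  perm_eq (incoming D) (enum (edge D)) && perm_eq (outgoing D) (enum (edge D)).

(** Number of connected components of the graph on [T] with edge list [r]. *)
Definition ncomp (T : finType) (r : seq (T * T)) : nat :=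
  n_comp [rel x y | ((x, y) \in r) || ((y, x) \in r)] T.

Definition incidences (D : piece) : seq (edge D * edge D) :=
  flatten [seq [:: (bl c, br c); (bl c, tl c); (bl c, tr c)]
          | c <- crossings D] ++ joints D.

(** [(e, true)] and [(e, false)] are the left and the right side of the
    oriented edge [e].  Two sides are linked when they meet in a corner of a
    node, so that in a closed piece the components are the face boundaries. *)
Definition corners (D : piece) : seq ((edge D * bool) * (edge D * bool)) :=
  flatten [seq [:: ((bl c, true), (tl c, true)); ((br c, false), (tr c, false));
                   ((bl c, false), (br c, true)); ((tl c, false), (tr c, true))]
          | c <- crossings D] ++
  flatten [seq [:: ((j.1, true), (j.2, true)); ((j.1, false), (j.2, false))]
          | j <- joints D].

(** V - E + F = 2C, i.e. every connected component of the combinatorial map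
    has genus zero. *)
Definition planar_piece (D : piece) : bool :=
  size (crossings D) + size (joints D) + ncomp (corners D)
  == #|edge D| + 2 * ncomp (incidences D).

Record diagram := Diagram {
  piece_of :> piece;
  diagram_closed : closed_piece piece_of;
  diagram_planar : planar_piece piece_of
}.

(** * Planar isotopy *)

Definition iso (D D' : piece) : Prop :=
  exists phi : edge D -> edge D',
    [/\ bijective phi,
        perm_eq [seq map_crossing phi phi c | c <- crossings D] (crossings D')
      & perm_eq [seq (phi j.1, phi j.2) | j <- joints D] (joints D')].

(** A new marked point on [e]: [Some e] is now the initial part of the old
    edge and [None] its final part. *)
Definition subdivide (D : piece) (e : edge D) : piece :=
  let head x := if x == e then None else Some x in
  Piece ([seq map_crossing head Some c | c <- crossings D])
        ((Some e, None) :: [seq (head j.1, Some j.2) | j <- joints D]).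

Definition planar_isotopy (D D' : diagram) : Prop :=
  iso D D' \/ exists e : edge D, iso (subdivide e) D'.

(** * Local moves *)

(** The content of a disk whose surroundings have edge set [I].  The edges
    meeting the boundary of the disk are elements of [I]; the edges in [inner]
    lie inside the disk. *)
Record tangle (I : finType) := Tangle {
  inner : finType;
  tcrossings : seq (crossing (I + inner));
  tjoints : seq ((I + inner) * (I + inner))
}.

Definition glue (K : piece) (T : tangle (edge K)) : piece :=
  Piece ([seq map_crossing inl inl c | c <- crossings K] ++ tcrossings T)
        ([seq (inl j.1, inl j.2) | j <- joints K] ++ tjoints T).

(** Unoriented picture of a node: strand u goes from the bottom left edge [ul]
    to the top right edge [uu], strand v from the bottom right edge [vl] to the
    top left edge [vu].  The strand u (resp. v) is oriented upward if [ru]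
    (resp. [rv]) is false and downward if it is true; the four cases turn the
    picture by a multiple of a quarter turn so that both strands point up. *)
Definition xc (E : Type) (k : ckind) (ru rv : bool) (ul uu vl vu : E) :
    crossing E :=
  match ru, rv with
  | false, false => Crossing k ul vl vu uu
  | false, true  => Crossing k vu ul uu vl
  | true,  false => Crossing k vl uu ul vu
  | true,  true  => Crossing k uu vu vl ul
  end.

(** Sign of the classical crossing [xc _ ru rv _ _ _ _] when strand u passes
    over strand v ([uover = true]) or under it ([uover = false]). *)
Definition csign (uover ru rv : bool) : ckind :=
  signed (uover (+) ru (+) rv).

(** Crossingless arc between [s] and [t], oriented from [s] to [t] if [r] is
    false and from [t] to [s] if it is true. *)
Definition arc (E : Type) (r : bool) (s t : E) : E * E :=
  if r then (t, s) else (s, t).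

Section Tangles.
Variable I : finType.

Definition straight (a b : I) : tangle I :=
  @Tangle I void [::] [:: (inl a, inl b)].

Definition kink_left (k : ckind) (a b : I) : tangle I :=
  @Tangle I unit [:: Crossing k (inr tt) (inl a) (inr tt) (inl b)] [::].

Definition kink_right (k : ckind) (a b : I) : tangle I :=
  @Tangle I unit [:: Crossing k (inl a) (inr tt) (inl b) (inr tt)] [::].

(** In the next pictures strand i joins the bottom end [si] to the top end
    [ti] and is oriented according to [ri]; the bottom ends are numbered from
    left to right. *)

Definition two_arcs (r1 r2 : bool) (s1 t1 s2 t2 : I) : tangle I :=
  @Tangle I void [::] [:: arc r1 (inl s1) (inl t1); arc r2 (inl s2) (inl t2)].

(** Two strands crossing twice, with a node of kind [k] below one of kind
    [k']; the bigon is bounded by the inner edges of strands 1 and 2. *)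
Definition bigon (k k' : ckind) (r1 r2 : bool) (s1 t1 s2 t2 : I) : tangle I :=
  let m1 := inr (@Ordinal 2 0 isT) in
  let m2 := inr (@Ordinal 2 1 isT) in
  @Tangle I 'I_2
    [:: xc k r1 r2 (inl s1) m1 (inl s2) m2;
        xc k' r2 r1 m2 (inl t2) m1 (inl t1)]
    [::].

(** Three pairwise crossing strands, the node of strands i and j having kind
    [kij].  From bottom to top the crossing pairs are 12, 13, 23 in the first
    picture and 23, 13, 12 in the second one. *)
Definition triangle (k12 k13 k23 : ckind) (r1 r2 r3 : bool)
    (s1 t1 s2 t2 s3 t3 : I) : tangle I :=
  let m1 := inr (@Ordinal 3 0 isT) in
  let m2 := inr (@Ordinal 3 1 isT) in
  let m3 := inr (@Ordinal 3 2 isT) in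
  @Tangle I 'I_3
    [:: xc k12 r1 r2 (inl s1) m1 (inl s2) m2;
        xc k13 r1 r3 m1 (inl t1) (inl s3) m3;
        xc k23 r2 r3 m2 (inl t2) m3 (inl t3)]
    [::].

Definition triangle' (k12 k13 k23 : ckind) (r1 r2 r3 : bool)
    (s1 t1 s2 t2 s3 t3 : I) : tangle I :=
  let m1 := inr (@Ordinal 3 0 isT) in
  let m2 := inr (@Ordinal 3 1 isT) in
  let m3 := inr (@Ordinal 3 2 isT) in
  @Tangle I 'I_3
    [:: xc k23 r2 r3 (inl s2) m2 (inl s3) m3;
        xc k13 r1 r3 (inl s1) m1 m3 (inl t3);
        xc k12 r1 r2 m1 (inl t1) m2 (inl t2)]
    [::].

(** Every orientation is covered by [r1], [r2], [r3].
    - RII: strand 1 is over at both crossings if [o], under at both otherwise.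
    - RIII: [h1], [h2], [h3] are the heights of the three strands.
    - pII: [signed s] is the kept sign of the classical crossing.
    - pIII: strands 1 and 2 meet at the vertex and strand 3 passes over both
      if [~~ o], under both if [o].  Up to rotating the picture and renaming
      strands this is the only choice of the moving strand. *)
Inductive singular_move : tangle I -> tangle I -> Prop :=
| move_RI_left (s : bool) (a b : I) :
    singular_move (kink_left (signed s) a b) (straight a b)
| move_RI_right (s : bool) (a b : I) :
    singular_move (kink_right (signed s) a b) (straight a b)
| move_RII (o r1 r2 : bool) (s1 t1 s2 t2 : I) :
    singular_move
      (bigon (csign o r1 r2) (csign (~~ o) r2 r1) r1 r2 s1 t1 s2 t2)
      (two_arcs r1 r2 s1 t1 s2 t2)
| move_RIII (h1 h2 h3 : nat) (r1 r2 r3 : bool) (s1 t1 s2 t2 s3 t3 : I) :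
    uniq [:: h1; h2; h3] ->
    let k12 := csign (h2 < h1) r1 r2 in
    let k13 := csign (h3 < h1) r1 r3 in
    let k23 := csign (h3 < h2) r2 r3 in
    singular_move
      (triangle k12 k13 k23 r1 r2 r3 s1 t1 s2 t2 s3 t3)
      (triangle' k12 k13 k23 r1 r2 r3 s1 t1 s2 t2 s3 t3)
| move_pII (s r1 r2 : bool) (s1 t1 s2 t2 : I) :
    singular_move
      (bigon (signed s) Vertex r1 r2 s1 t1 s2 t2)
      (bigon Vertex (signed s) r1 r2 s1 t1 s2 t2)
| move_pIII (o r1 r2 r3 : bool) (s1 t1 s2 t2 s3 t3 : I) :
    let k13 := csign o r1 r3 in
    let k23 := csign o r2 r3 in
    singular_move
      (triangle Vertex k13 k23 r1 r2 r3 s1 t1 s2 t2 s3 t3)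
      (triangle' Vertex k13 k23 r1 r2 r3 s1 t1 s2 t2 s3 t3).

Inductive pseudo_move : tangle I -> tangle I -> Prop :=
| move_singular (T T' : tangle I) : singular_move T T' -> pseudo_move T T'
| move_pI_left (a b : I) :
    pseudo_move (kink_left Vertex a b) (straight a b)
| move_pI_right (a b : I) :
    pseudo_move (kink_right Vertex a b) (straight a b).

End Tangles.

(** [D'] is obtained from [D] by replacing the content of a disk.  Both
    diagrams are plane, so a move never introduces a virtual crossing. *)
Definition local_move (M : forall I : finType, tangle I -> tangle I -> Prop)
    (D D' : diagram) : Prop :=
  exists (K : piece) (T T' : tangle (edge K)),
    [/\ M (edge K) T T', iso (glue T) D & iso (glue T') D'].

Definition singular_isotopic : diagram -> diagram -> Prop :=
  clos_refl_sym_trans diagram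
    (fun D D' => planar_isotopy D D' \/ local_move singular_move D D').

Definition pseudo_isotopic : diagram -> diagram -> Prop :=
  clos_refl_sym_trans diagram
    (fun D D' => planar_isotopy D D' \/ local_move pseudo_move D D').

(** * Colorings and the state sum *)

Section Invariant.
Variables (X : finType) (Q : psyquandle X).

Section Colors.
Variables (E : Type) (f : E -> X).

Definition label_pair (c : crossing E) : X * X :=
  match kind c with
  | Positive | Vertex => (f (tl c), f (bl c))
  | Negative => (f (bl c), f (tl c))
  end.

Definition crossing_rule (c : crossing E) : bool :=
  let: (x, y) := label_pair c in
  match kind c with
  | Positive => (f (br c) == ut Q x y) && (f (tr c) == ot Q y x)
  | Negative => (f (tr c) == ut Q x y) && (f (br c) == ot Q y x)
  | Vertex => (f (br c) == ub Q x y) && (f (tr c) == ob Q y x)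
  end.

End Colors.

Definition is_coloring (D : piece) (f : {ffun edge D -> X}) : bool :=
  all (crossing_rule f) (crossings D) && all (fun j => f j.1 == f j.2) (joints D).

(** A Kauffman state is a list of booleans, one for each crossing or vertex;
    [true] stands for the oriented smoothing. *)
Definition smoothing (E : Type) (c : crossing E) (b : bool) : seq (E * E) :=
  if b then [:: (bl c, tl c); (br c, tr c)] else [:: (bl c, br c); (tl c, tr c)].

Definition state_circles (D : piece) (s : seq bool) : nat :=
  ncomp (flatten [seq smoothing p.1 p.2 | p <- zip (crossings D) s] ++ joints D).

Variables (R : comPzRingType) (beta : bracket Q R).
Local Open Scope ring_scope.

Definition coefficient (E : Type) (f : E -> X) (c : crossing E) (b : bool) : R :=
  let: (x, y) := label_pair f c in
  match kind c with
  | Positive => if b then bA beta x y else bB beta x y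
  | Negative => if b then bAV beta x y else bBV beta x y
  | Vertex => if b then bP beta x y else bS beta x y
  end.

Definition num_kind (D : piece) (k : ckind) : nat :=
  count (fun c => kind c == k) (crossings D).

(** The factor w^(n - p) is written as w^n times the p-th power of the inverse
    of w. *)
Definition state_sum (D : piece) (f : {ffun edge D -> X}) : R :=
  bw beta ^+ num_kind D Negative * bwV beta ^+ num_kind D Positive *
  \sum_(s : (size (crossings D)).-tuple bool)
     bd beta ^+ state_circles D s *
     \prod_(p <- zip (crossings D) s) coefficient f p.1 p.2.

Definition Phi (D : piece) : {mset R}%mset :=
  seq_mset [seq state_sum f | f <- enum (@is_coloring D)].

End Invariant.

(* Main.v *)
Require Import Defs.
From mathcomp Require Import all_boot all_algebra.
From mathcomp Require Import finmap multiset ring zify.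

Set Implicit Arguments.
Unset Strict Implicit.
Unset Printing Implicit Defensive.

Import GRing.Theory.

(** The state sum is local: a diagram cut along a disk contributes, for each
    state inside the disk, only the way in which the ends on the boundary are
    joined and the number of circles that close up inside.  So a local move
    preserves the multiset of state sums as soon as, for every colouring of the
    surroundings, both pictures have the same number of colourings extending it
    (it is always 0 or 1) and the same coefficient in front of every matching
    of the ends ([Phi_glue]).

    After sharing the writhe factor out among the crossings, the axioms of a
    bracket give these equalities for one orientation of each move, all strands
    pointing upward.  The other orientations and heights follow formally, once
    a crossing is treated without orientation, as a node with four cyclically
    ordered ends: any two neighbouring colours determine the others, turning
    the node exchanges its two smoothings, and a crossing has an inverse.

    - For three strands ([hexagon]), the relation may be turned by a sixth of a
      turn, and multiplying it on both sides by the inverse of a crossing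
      exchanges two neighbouring strands.  These two operations reach all
      orientations and heights of RIII ([xc_node_RIII]) from the upward one, and
      all cases of pIII ([xc_node_pIII]) from the two upward ones.
    - For pII ([exchange]), parallel strands are given by the axioms.  For
      opposite strands ([exchange_antiparallel]), joining two neighbouring ends
      in pIII and removing the kink shows that a strand leaving a vertex may
      cross one of its neighbours or go around and cross the two other ends.
      Doing this with an overcrossing strand, applying the parallel pII, and
      doing it again with an undercrossing strand takes the crossing through the
      vertex.
    - RII and the kinks are the equations defining w and delta, and the
      condition for pI is what makes a kink at a vertex removable.

    That the smoothings of a bigon, a triangle or a kink join their ends as they
    seem to is checked by computation on numbered edges ([skein_states]). *)

(** * Components of graphs given by edge lists *)

Definition adjacent (T : finType) (r : seq (T * T)) : rel T :=
  [rel x y | ((x, y) \in r) || ((y, x) \in r)].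

Definition linked (T : finType) (r : seq (T * T)) : rel T :=
  connect (adjacent r).

Lemma linked_sym (T : finType) (r : seq (T * T)) x y :
  linked r x y = linked r y x.
Proof.
by apply: sym_connect_sym => {}x {}y; rewrite /adjacent /= orbC.
Qed.

Lemma linked_edge (T : finType) (r : seq (T * T)) x y :
  (x, y) \in r -> linked r x y.
Proof. by move=> xy; apply: connect1; rewrite /adjacent /= xy. Qed.

Lemma linked_map (T T' : finType) (r : seq (T * T)) (r' : seq (T' * T'))
    (f : T -> T') :
    (forall x y, (x, y) \in r -> linked r' (f x) (f y)) ->
  forall x y, linked r x y -> linked r' (f x) (f y).
Proof.
move=> edge x _ /connectP[p xp ->].
elim: p x xp => [|z p IHp] x /=; first by rewrite /linked connect0.
move=> /andP[/orP xz /IHp]; apply: connect_trans.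
by case: xz => /edge //; rewrite linked_sym.
Qed.

Lemma linked_sub (T : finType) (r r' : seq (T * T)) :
  {subset r <= r'} -> forall x y, linked r x y -> linked r' x y.
Proof. by move=> rr'; apply: (@linked_map _ _ r r' id) => x y /rr'/linked_edge. Qed.

(** A map that links only what was linked sends the roots of distinct components
    to distinct components. *)
Lemma ncomp_le (T T' : finType) (r : seq (T * T)) (r' : seq (T' * T'))
    (f : T -> T') :
    (forall x y, linked r' (f x) (f y) -> linked r x y) ->
  ncomp r <= ncomp r'.
Proof.
move=> fr; rewrite /ncomp /n_comp_mem.
have sym := @linked_sym T r; have sym' := @linked_sym T' r'.
pose g x := fingraph.root (adjacent r') (f x).
have ginj : {in predI (roots (adjacent r)) T &, injective g}.
  move=> x y; rewrite !inE !andbT => /eqP rx /eqP ry /eqP gxy.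
  have: linked r x y by apply: fr; rewrite /linked -(root_connect sym').
  by rewrite /linked -(root_connect sym) rx ry => /eqP.
rewrite -(card_in_image ginj); apply: subset_leq_card.
apply/subsetP=> _ /imageP[x _ ->].
by rewrite !inE andbT; exact: (roots_root sym').
Qed.

(** The form in which circle counts are compared below: [f] and [g] are graph
    maps, inverse to each other up to the links of the graphs. *)
Lemma ncomp_equiv (T T' : finType) (r : seq (T * T)) (r' : seq (T' * T'))
    (f : T -> T') (g : T' -> T) :
    (forall x y, (x, y) \in r -> linked r' (f x) (f y)) ->
    (forall x y, (x, y) \in r' -> linked r (g x) (g y)) ->
    (forall x, linked r x (g (f x))) ->
    (forall y, linked r' y (f (g y))) ->
  ncomp r = ncomp r'.
Proof.
move=> /linked_map fr /linked_map gr gfK fgK.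
apply/eqP; rewrite eqn_leq; apply/andP; split.
  apply: (@ncomp_le _ _ _ _ f) => x y /gr xy.
  apply: connect_trans (gfK x) _; apply: connect_trans xy _.
  by have := gfK y; rewrite linked_sym.
apply: (@ncomp_le _ _ _ _ g) => x y /fr xy.
apply: connect_trans (fgK x) _; apply: connect_trans xy _.
by have := fgK y; rewrite linked_sym.
Qed.

Definition map_edge (T T' : Type) (f : T -> T') (p : T * T) := (f p.1, f p.2).

Lemma mem_map_edge (T T' : eqType) (f : T -> T') (r : seq (T * T)) x y :
  (x, y) \in r -> (f x, f y) \in map (map_edge f) r.
Proof. exact: map_f. Qed.

Lemma linked_image (T T' : finType) (f : T -> T') (r : seq (T * T)) x y :
  linked r x y -> linked (map (map_edge f) r) (f x) (f y).
Proof.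
by apply: linked_map => {}x {}y /(mem_map_edge f)/linked_edge.
Qed.

(** The added vertex [None] stands for a circle inside a disk that does not meet
    its boundary. *)
Lemma ncomp_isolated (T : finType) (r : seq (T * T)) :
  ncomp (map (map_edge (@Some T)) r) = (ncomp r).+1.
Proof.
set r' := map _ _.
have sym := @linked_sym T r; have sym' := @linked_sym _ r'.
have toS x y : linked r x y -> linked r' (Some x) (Some y).
  exact: linked_image.
have ofS u v : linked r' u v ->
    match u, v with
    | Some x, Some y => linked r x y | None, None => true | _, _ => false
    end.
  case/connectP=> p up ->; elim: p u up => [|z p IHp] u /=.
    by case: u => // x; rewrite /linked connect0.
  case/andP=> uz /IHp; move: uz; rewrite /r' /adjacent /=.
  case/orP=> /mapP[[x y] /= xy [-> ->]]; case: (last _ p) => // t.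
    by apply: connect_trans; apply: linked_edge.
  by apply: connect_trans; rewrite -/(linked _ _ _) linked_sym linked_edge.
rewrite /ncomp /n_comp_mem.
have rN : roots (adjacent r') None.
  have: linked r' None (fingraph.root (adjacent r') None) by exact: connect_root.
  by move/ofS; rewrite /roots; case: (fingraph.root _ _).
transitivity #|predU1 None [pred u | roots (adjacent r') u && (u != None)]|.
  apply: eq_card => u; rewrite !inE andbT.
  by case: eqP => [->|_]; rewrite ?andbT //; exact: rN.
rewrite cardU1 /= [_ \in _]inE eqxx andbF /= add1n; congr _.+1.
pose h x := fingraph.root (adjacent r') (Some x).
have hS x : exists y, h x = Some y.
  have: linked r' (Some x) (h x) by exact: connect_root.
  by move/ofS; case: (h x) => // y _; exists y.
have hinj : {in predI (roots (adjacent r)) T &, injective h}.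
  move=> x y; rewrite !inE !andbT => /eqP rx /eqP ry /eqP.
  rewrite /h (root_connect sym') => /ofS.
  by rewrite /linked -(root_connect sym) rx ry => /eqP.
rewrite -(card_in_image hinj); apply: eq_card => u.
rewrite [LHS]inE /=; apply/idP/idP.
  case: u => [x|]; rewrite ?andbF // andbT => /eqP rx.
  apply/imageP; exists (fingraph.root (adjacent r) x).
    by rewrite !inE andbT; exact: (roots_root sym).
  rewrite -rx; apply/eqP; rewrite (root_connect sym').
  by apply: toS; exact: connect_root.
case/imageP=> x _ ->; have [y hy] := hS x; rewrite hy andbT -hy.
exact: (roots_root sym').
Qed.

Definition links_in (T : finType) (r r' : seq (T * T)) : Prop :=
  forall x y, (x, y) \in r -> linked r' x y.

Lemma links_in_linked (T : finType) (r r' : seq (T * T)) x y :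
  links_in r r' -> linked r x y -> linked r' x y.
Proof. by move=> rr'; apply: (@linked_map _ _ r r' id). Qed.

Lemma links_in_sub (T : finType) (r r' : seq (T * T)) :
  {subset r <= r'} -> links_in r r'.
Proof. by move=> rr' x y /rr'/linked_edge. Qed.

Lemma links_in_cat (T : finType) (s s' r r' : seq (T * T)) :
  links_in s s' -> links_in r r' -> links_in (s ++ r) (s' ++ r').
Proof.
by move=> ss' rr' x y; rewrite mem_cat => /orP[/ss' | /rr'];
   apply: linked_sub => p pr; rewrite mem_cat pr ?orbT.
Qed.

Lemma ncomp_links (T : finType) (r r' : seq (T * T)) :
  links_in r r' -> links_in r' r -> ncomp r = ncomp r'.
Proof.
by move=> rr' r'r; apply: (@ncomp_equiv _ _ r r' id id) => // x;
   rewrite /linked connect0.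
Qed.

(** * Skein sums *)

(** The ends of a node in counterclockwise order, the first one at the bottom
    left, and its two smoothings. *)
Definition ends (E : Type) := (E * E * E * E)%type.

Definition vsplit (E : Type) (q : ends E) : seq (E * E) :=
  let: (a, b, c, e) := q in [:: (a, e); (b, c)].
Definition hsplit (E : Type) (q : ends E) : seq (E * E) :=
  let: (a, b, c, e) := q in [:: (a, b); (c, e)].

Definition map_ends (E E' : Type) (f : E -> E') (q : ends E) : ends E' :=
  let: (a, b, c, e) := q in (f a, f b, f c, f e).

Lemma vsplit_map (E E' : Type) (f : E -> E') q :
  vsplit (map_ends f q) = map (map_edge f) (vsplit q).
Proof. by case: q => [[[a b] c] e]. Qed.

Lemma hsplit_map (E E' : Type) (f : E -> E') q :
  hsplit (map_ends f q) = map (map_edge f) (hsplit q).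
Proof. by case: q => [[[a b] c] e]. Qed.

Section SkeinSum.
Local Open Scope ring_scope.
Variables (R : comPzRingType) (d : R).

(** The state sum by its recursion on the crossings.  The coefficients are
    arbitrary, so that a node may be replaced by a turned copy or by another
    labelling of its edges without reference to the bracket. *)
Fixpoint skein (E : finType) (ns : seq (ends E * (R * R))) (r : seq (E * E)) : R :=
  if ns is n :: ns' then
    n.2.1 * skein ns' (vsplit n.1 ++ r) + n.2.2 * skein ns' (hsplit n.1 ++ r)
  else d ^+ ncomp r.

Lemma skein_links (E : finType) (ns : seq (ends E * (R * R))) r r' :
  links_in r r' -> links_in r' r -> skein ns r = skein ns r'.
Proof.
elim: ns r r' => [|n ns IHns] r r' rr' r'r /=; first by rewrite (ncomp_links rr').
by congr (_ * _ + _ * _); apply: IHns; apply: links_in_cat => //; apply: links_in_sub.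
Qed.

Lemma skein_mem (E : finType) (ns : seq (ends E * (R * R))) r r' :
  r =i r' -> skein ns r = skein ns r'.
Proof.
by move=> rr'; apply: skein_links; apply: links_in_sub => p; rewrite rr'.
Qed.

Lemma skein_mid (E : finType) (ns1 ns2 : seq (ends E * (R * R))) n r :
  skein (ns1 ++ n :: ns2) r = skein (n :: ns1 ++ ns2) r.
Proof.
elim: ns1 r => [//|m ns1 IHns1] r; rewrite !cat_cons /= !IHns1 /=.
have swap s t : skein (ns1 ++ ns2) (s ++ t ++ r) = skein (ns1 ++ ns2) (t ++ s ++ r).
  by apply: skein_mem => p; rewrite !mem_cat orbCA.
by rewrite !(swap (vsplit m.1)) !(swap (hsplit m.1)); ring.
Qed.

Lemma skein_perm (E : finType) (ns ns' : seq (ends E * (R * R))) r :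
  perm_eq ns ns' -> skein ns r = skein ns' r.
Proof.
elim: ns ns' r => [|n ns IHns] ns' r.
  by rewrite perm_sym => /perm_nilP ->.
move=> nsP; have := mem_head n ns; rewrite (perm_mem nsP) => n_ns'.
case/splitPr: n_ns' nsP => ns1 ns2 nsP.
have {}nsP : perm_eq ns (ns1 ++ ns2).
  by rewrite -(perm_cons n) (permPl nsP) -(cat1s n ns2) perm_catCA.
by rewrite skein_mid /=; congr (_ * _ + _ * _); apply: IHns.
Qed.

(** Turning a node by a quarter turn exchanges its two smoothings. *)
Lemma skein_turn (E : finType) (ns : seq (ends E * (R * R))) r a b c e (al be : R) :
  skein (((a, b, c, e), (al, be)) :: ns) r =
  skein (((b, c, e, a), (be, al)) :: ns) r.
Proof.
have flip (x y z t : E) : links_in [:: (x, y); (z, t)] [:: (y, x); (z, t)].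
  move=> u v; rewrite !inE => /orP[]/eqP[-> ->]; [rewrite linked_sym|];
  by apply: linked_edge; rewrite !inE eqxx ?orbT.
have swap (x y z t : E) : links_in [:: (x, y); (z, t)] [:: (z, t); (x, y)].
  by apply: links_in_sub => p; rewrite !inE orbC.
have rr : links_in r r by apply: links_in_sub.
rewrite /= addrC; congr (_ * _ + _ * _); apply: skein_links;
  apply: (@links_in_cat _ [:: _; _] [:: _; _]) => //.
- by move=> x y /flip; apply: links_in_linked; apply: swap.
- by move=> x y /linked_edge/(links_in_linked (swap _ _ _ _));
     apply: links_in_linked; apply: flip.
Qed.

(** [h] may merge edges that are linked anyway: this covers both renaming the
    edges and forgetting a marked point. *)
Lemma skein_collapse (E E' : finType) (h : E' -> E) (g : E -> E') ns r :
    cancel g h -> (forall x, linked r x (g (h x))) ->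
  skein [seq (map_ends h n.1, n.2) | n <- ns] (map (map_edge h) r) = skein ns r.
Proof.
move=> gK; elim: ns r => [|n ns IHns] r hK /=.
  congr (_ ^+ _); apply: (@ncomp_equiv _ _ _ _ g h) => //.
  - move=> x y /mapP[[u v] uv [-> ->]]; rewrite /=.
    apply: connect_trans (_ : linked r u _); first by rewrite -/(linked _ _ _) linked_sym.
    by apply: connect_trans (hK v); apply: linked_edge.
  - by move=> x y /(mem_map_edge h)/linked_edge.
  - by move=> x; rewrite gK /linked connect0.
by rewrite vsplit_map hsplit_map -!map_cat; congr (_ * _ + _ * _); apply: IHns => x;
   apply: linked_sub (hK x) => p pr; rewrite mem_cat pr orbT.
Qed.

(** If two contents of a disk agree whatever arcs [r] join its ends outside, they
    agree in front of any common surroundings [ns], because each state of the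
    surroundings is such a family of arcs. *)
Lemma skein_cat_eq (E E1 E2 : finType) (f1 : E -> E1) (f2 : E -> E2) ns ns1 ns2 j1 j2 :
    (forall r, skein ns1 (map (map_edge f1) r ++ j1) =
               skein ns2 (map (map_edge f2) r ++ j2)) ->
  forall r,
  skein ([seq (map_ends f1 n.1, n.2) | n <- ns] ++ ns1) (map (map_edge f1) r ++ j1) =
  skein ([seq (map_ends f2 n.1, n.2) | n <- ns] ++ ns2) (map (map_edge f2) r ++ j2).
Proof.
move=> eq12; elim: ns => [//|n ns IHns] r /=.
by rewrite !vsplit_map !hsplit_map !catA -!map_cat !IHns.
Qed.

End SkeinSum.

(** * The state sum as a skein sum *)

Section StateSum.
Local Open Scope ring_scope.
Variables (X : finType) (Q : psyquandle X) (R : comPzRingType) (beta : bracket Q R).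

(** The writhe factor is shared out among the crossings.  With these weights a
    kink has value 1, and the relations with equally many crossings of each sign
    on both sides are unchanged. *)
Definition writhe_factor (k : ckind) : R :=
  match k with Positive => bwV beta | Negative => bw beta | Vertex => 1 end.

Definition weight (E : Type) (f : E -> X) (c : crossing E) (b : bool) : R :=
  writhe_factor (kind c) * coefficient beta f c b.

Definition crossing_ends (E : Type) (c : crossing E) : ends E :=
  (bl c, br c, tr c, tl c).

Definition skein_node (E : Type) (f : E -> X) (c : crossing E) : ends E * (R * R) :=
  (crossing_ends c, (weight f c true, weight f c false)).

Lemma sum_tuple_cons n (F : seq bool -> R) :
  \sum_(s : n.+1.-tuple bool) F s =
  \sum_(s : n.-tuple bool) F (true :: s) + \sum_(s : n.-tuple bool) F (false :: s).
Proof.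
rewrite (reindex (fun p : bool * n.-tuple bool => [tuple of p.1 :: p.2])) /=.
  by rewrite -(pair_bigA _ (fun b (s : n.-tuple bool) => F (b :: s))) big_bool.
exists (fun s => (thead s, [tuple of behead s])) => [[b s] _|s _] /=.
  by congr pair; apply: val_inj.
by rewrite [in RHS](tuple_eta s); apply: val_inj.
Qed.

Lemma skein_sum (E : finType) (f : E -> X) (cs : seq (crossing E)) r :
  skein (bd beta) [seq skein_node f c | c <- cs] r =
  \sum_(s : (size cs).-tuple bool)
     bd beta ^+ ncomp (flatten [seq smoothing p.1 p.2 | p <- zip cs s] ++ r) *
     \prod_(p <- zip cs s) weight f p.1 p.2.
Proof.
elim: cs r => [|c cs IHcs] r.
  rewrite (big_pred1 [tuple]) => [|s]; first by rewrite big_nil mulr1.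
  by apply/esym/eqP; apply: tuple0.
pose F s := bd beta ^+ ncomp (flatten [seq smoothing p.1 p.2 | p <- zip (c :: cs) s] ++ r)
            * \prod_(p <- zip (c :: cs) s) weight f p.1 p.2.
rewrite (sum_tuple_cons _ F) /= !IHcs !big_distrr /F /=.
have eq_term b q (s : seq bool) :
  links_in q (smoothing c b) -> links_in (smoothing c b) q ->
  weight f c b *
    (bd beta ^+ ncomp (flatten [seq smoothing p.1 p.2 | p <- zip cs s] ++ q ++ r)
            * \prod_(p <- zip cs s) weight f p.1 p.2) =
  bd beta ^+ ncomp (flatten [seq smoothing p.1 p.2 | p <- zip (c :: cs) (b :: s)] ++ r)
            * \prod_(p <- zip (c :: cs) (b :: s)) weight f p.1 p.2.
  move=> qs sq; rewrite big_cons /= mulrCA; congr (_ ^+ _ * _).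
  set t := flatten _; transitivity (ncomp (t ++ smoothing c b ++ r)).
    have rr : links_in r r by apply: links_in_sub.
    have tt : links_in t t by apply: links_in_sub.
    by apply: ncomp_links; do 2!apply: links_in_cat => //.
  by apply: ncomp_links; apply: links_in_sub => p; rewrite !mem_cat orbCA orbA.
congr (_ + _); apply: eq_bigr => s _.
  by apply: (eq_term true (vsplit (crossing_ends c))); apply: links_in_sub.
apply: (eq_term false (hsplit (crossing_ends c))) => x y;
  rewrite !inE => /orP[]/eqP[-> ->];
  first [by apply: linked_edge; rewrite !inE eqxx ?orbT
        |by rewrite linked_sym linked_edge // !inE eqxx ?orbT].
Qed.

Lemma prod_weight (E : eqType) (f : E -> X) (cs : seq (crossing E)) (s : seq bool) :
    size s = size cs ->
  \prod_(p <- zip cs s) weight f p.1 p.2 =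
  bw beta ^+ count (fun c => kind c == Negative) cs *
  bwV beta ^+ count (fun c => kind c == Positive) cs *
  \prod_(p <- zip cs s) coefficient beta f p.1 p.2.
Proof.
elim: cs s => [|c cs IHcs] [|b s] //= => [_|[/IHcs eqs]].
  by rewrite !big_nil !expr0 !mul1r.
rewrite !big_cons eqs /weight /=.
by case: (kind c) => /=; rewrite ?add0n ?add1n ?exprS; ring.
Qed.

Theorem state_sum_skein (D : piece) (f : {ffun edge D -> X}) :
  state_sum beta f =
  skein (bd beta) [seq skein_node f c | c <- crossings D] (joints D).
Proof.
rewrite skein_sum /state_sum big_distrr /=; apply: eq_bigr => s _.
rewrite prod_weight ?size_tuple // /state_circles /num_kind.
by rewrite mulrCA !mulrA.
Qed.

(** * Comparing the invariants of two pieces *)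

(** Colourings are matched by a relation [S] rather than by a map: in the moves,
    two colourings correspond when they agree outside a disk. *)
Lemma Phi_eq (D D' : piece) (S : {ffun edge D -> X} -> {ffun edge D' -> X} -> bool) :
    (forall f, is_coloring Q f -> exists2 f', is_coloring Q f' & S f f') ->
    (forall f', is_coloring Q f' -> exists2 f, is_coloring Q f & S f f') ->
    (forall f f1 f2, is_coloring Q f1 -> is_coloring Q f2 ->
       S f f1 -> S f f2 -> f1 = f2) ->
    (forall f1 f2 f', is_coloring Q f1 -> is_coloring Q f2 ->
       S f1 f' -> S f2 f' -> f1 = f2) ->
    (forall f f', is_coloring Q f -> is_coloring Q f' -> S f f' ->
       state_sum beta f = state_sum beta f') ->
  Phi beta D = Phi beta D'.
Proof.
move=> ex1 ex2 un1 un2 eqS; apply/eq_seq_msetP.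
pose g f := [pick f' | is_coloring Q f' && S f f'].
have gP f : is_coloring Q f ->
    exists f', [/\ g f = Some f', is_coloring Q f' & S f f'].
  move=> /ex1[f' f'C Sff']; rewrite /g; case: pickP => [f2 /andP[]|/(_ f')].
    by exists f2.
  by rewrite f'C Sff'.
pose C := enum (@is_coloring _ Q D); pose C' := enum (@is_coloring _ Q D').
have inC f : (f \in C) = is_coloring Q f by rewrite mem_enum.
have inC' f : (f \in C') = is_coloring Q f by rewrite mem_enum.
have gC : perm_eq [seq g f | f <- C] [seq Some f' | f' <- C'].
  apply: uniq_perm.
  - rewrite map_inj_in_uniq ?enum_uniq // => f1 f2; rewrite !inC => f1C f2C.
    have [f' [-> f'C S1]] := gP _ f1C; have [f'' [-> _ S2]] := gP _ f2C.
    by case=> eqf; apply: (un2 _ _ f') => //; rewrite eqf.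
  - by rewrite map_inj_uniq ?enum_uniq // => ? ? [].
  move=> o; apply/mapP/mapP => [[f]|[f']]; rewrite ?inC ?inC'.
    by move=> /gP[f' [-> f'C _]] ->; exists f'; rewrite ?inC'.
  move=> f'C ->; have [f fC Sff'] := ex2 _ f'C; exists f; rewrite ?inC //.
  have [f2 [-> f2C Sff2]] := gP _ fC; congr Some.
  exact: un1 Sff' Sff2.
pose F (o : option {ffun edge D' -> X}) : R := if o is Some f' then state_sum beta f' else 0.
have := perm_map F gC; rewrite -!map_comp; congr perm_eq.
apply/eq_in_map => f; rewrite inC => fC /=.
by have [f' [-> f'C Sff']] := gP _ fC; rewrite (eqS _ _ fC f'C Sff').
Qed.

Lemma crossing_rule_map (E E' : eqType) (f : E -> X) (f' : E' -> X) a b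
    (c : crossing E) :
    (forall e, f' (a e) = f e) -> (forall e, f' (b e) = f e) ->
  crossing_rule Q f' (map_crossing a b c) = crossing_rule Q f c.
Proof.
by move=> fa fb; rewrite /crossing_rule /label_pair /=; case: (kind c) => /=;
   rewrite !fa !fb.
Qed.

Lemma weight_map (E E' : Type) (f : E -> X) (f' : E' -> X) a b (c : crossing E) s :
    (forall e, f' (a e) = f e) -> (forall e, f' (b e) = f e) ->
  weight f' (map_crossing a b c) s = weight f c s.
Proof.
by move=> fa fb; rewrite /weight /coefficient /label_pair /=; case: (kind c);
   rewrite !fa !fb.
Qed.

Lemma Phi_iso (D D' : piece) : iso D D' -> Phi beta D = Phi beta D'.
Proof.
case=> phi [[psi phiK psiK] cD jD].
have colE (f : {ffun edge D -> X}) (f' : {ffun edge D' -> X}) :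
    (forall e, f' (phi e) = f e) -> is_coloring Q f' = is_coloring Q f.
  move=> ff'; rewrite /is_coloring -(perm_all _ cD) -(perm_all _ jD) !all_map.
  congr (_ && _); apply: eq_all => c /=; first exact: crossing_rule_map.
  by rewrite !ff'.
pose S (f : {ffun edge D -> X}) (f' : {ffun edge D' -> X}) :=
  [forall e, f' (phi e) == f e].
have SP f f' : S f f' -> forall e, f' (phi e) = f e by move=> /forallP ff' e; apply/eqP.
apply: (@Phi_eq _ _ S).
- move=> f fC; exists [ffun e => f (psi e)]; last first.
    by apply/forallP=> e; rewrite ffunE phiK.
  by rewrite (colE f) // => e; rewrite ffunE phiK.
- move=> f' f'C; exists [ffun e => f' (phi e)]; last first.
    by apply/forallP=> e; rewrite ffunE.
  by rewrite -(colE _ f') // => e; rewrite ffunE.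
- move=> f f1 f2 _ _ /SP Sf1 /SP Sf2; apply/ffunP => e.
  by rewrite -(psiK e) Sf1 Sf2.
- move=> f1 f2 f' _ _ /SP Sf1 /SP Sf2; apply/ffunP => e.
  by rewrite -Sf1 -Sf2.
move=> f f' _ _ /SP ff'; rewrite !state_sum_skein.
rewrite -(skein_perm _ _ (perm_map (skein_node f') cD)).
rewrite -(@skein_mem _ _ _ _ _ _ (perm_mem jD)) -map_comp.
rewrite -[LHS](@skein_collapse _ _ _ _ phi psi) //; last first.
  by move=> x; rewrite phiK /linked connect0.
rewrite -map_comp; congr (skein _ _ _); apply: eq_map => c.
by rewrite /skein_node /= !(@weight_map _ _ f f').
Qed.

Lemma Phi_subdivide (D : piece) (e : edge D) :
  Phi beta (subdivide e) = Phi beta D.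
Proof.
pose head x := if x == e then None else Some x.
have colE (f' : {ffun edge (subdivide e) -> X}) (f : {ffun edge D -> X}) :
    (forall x, f' (Some x) = f x) ->
    is_coloring Q f' = is_coloring Q f && (f' None == f e).
  move=> ff'; rewrite /is_coloring /= ff' [f' None == _]eq_sym.
  case: eqP => [f'N|_]; last by rewrite !andbF.
  have fh x : f' (head x) = f x by rewrite /head; case: eqP => [->|].
  rewrite andbT andbC !all_map andbC.
  congr (_ && _); apply: eq_all => c /=; first exact: crossing_rule_map.
  by rewrite -/(head c.1) fh ff'.
pose S (f' : {ffun edge (subdivide e) -> X}) (f : {ffun edge D -> X}) :=
  [forall x, f' (Some x) == f x].
have SP f f' : S f' f -> forall x, f' (Some x) = f x by move=> /forallP ff' x; apply/eqP.
apply: (@Phi_eq _ _ S).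
- move=> f' f'C; exists [ffun x => f' (Some x)]; last first.
    by apply/forallP=> x; rewrite ffunE.
  by move: f'C; rewrite (colE f' [ffun x => f' (Some x)]) => [/andP[]|x]; rewrite ?ffunE.
- move=> f fC; exists [ffun x : edge (subdivide e) => if x is Some y then f y else f e];
    last by apply/forallP=> x; rewrite ffunE.
  by rewrite (colE _ f) => [|x]; rewrite ffunE ?fC ?eqxx.
- by move=> f' f1 f2 _ _ /SP Sf1 /SP Sf2; apply/ffunP => x; rewrite -Sf1 -Sf2.
- move=> f1 f2 f f1C f2C /SP Sf1 /SP Sf2; apply/ffunP => -[x|].
    by rewrite Sf1 Sf2.
  move: f1C f2C; rewrite !(colE _ f) // => /andP[_ /eqP->] /andP[_ /eqP->].
  by [].
move=> f' f f'C _ /SP ff'; rewrite !state_sum_skein.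
have /eqP f'N : f' None == f e by move: f'C; rewrite (colE _ f) // => /andP[].
have fh x : f' (head x) = f x by rewrite /head; case: eqP => [->|].
pose h (x : edge (subdivide e)) := if x is Some y then y else e.
have hh x : h (head x) = x by rewrite /head; case: eqP.
rewrite -[LHS](@skein_collapse _ _ _ _ h Some) //; last first.
  case=> [x|] /=; first by rewrite /linked connect0.
  by rewrite linked_sym linked_edge // mem_head.
rewrite /= -!map_comp.
transitivity (skein (bd beta) [seq skein_node f c | c <- crossings D] ((e, e) :: joints D)).
  congr (skein _ _ (_ :: _)).
    apply: eq_map => c; rewrite /skein_node /= !(@weight_map _ _ f f') //.
    by rewrite -/(head (bl c)) -/(head (br c)) !hh; case: c.
  by rewrite -[RHS]map_id; apply: eq_map => -[x y]; rewrite /map_edge /= -/(head x) hh.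
apply: skein_links => x y; last by move=> xy; apply: linked_edge; rewrite inE xy orbT.
by rewrite inE => /orP[/eqP[-> ->]|/linked_edge //]; rewrite /linked connect0.
Qed.

End StateSum.

(** * Evaluating the states of a tangle *)

(** A smoothed tangle joins its ends in pairs; what it contributes to the
    circles of a diagram is this matching [M], plus one circle if some inner
    edges close up inside the disk.  [f] sends an inner edge to an end that it
    is joined to, if there is one. *)
Lemma ncomp_contract (I J : finType) (st : seq ((I + J) * (I + J)))
    (M r : seq (I * I)) (f : J -> option I) :
    let h x := match x with inl i => Some i | inr j => f j end in
    (forall j i, f j = Some i -> linked st (inr j) (inl i)) ->
    (forall j j', f j = None -> f j' = None -> linked st (inr j) (inr j')) ->
    (forall x y, (x, y) \in st ->
       match h x, h y with
       | Some a, Some b => linked M a b | None, None => true | _, _ => false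
       end) ->
    (forall a b, (a, b) \in M -> linked st (inl a) (inl b)) ->
  ncomp (st ++ map (map_edge inl) r) = [exists j, f j == None] + ncomp (M ++ r).
Proof.
move=> h fS fN stM Mst.
set G := st ++ _; have stG x y : linked st x y -> linked G x y.
  by apply: linked_sub => p pst; rewrite mem_cat pst.
have MG a b : (a, b) \in M ++ r -> linked G (inl a) (inl b).
  rewrite mem_cat => /orP[/Mst/stG // | /(mem_map_edge (@inl I J)) ab].
  by apply: linked_edge; rewrite mem_cat ab orbT.
have MMr a b : linked M a b -> linked (M ++ r) a b.
  by apply: linked_sub => p pM; rewrite mem_cat pM.
have hG x y : (x, y) \in G ->
    match h x, h y with
    | Some a, Some b => linked (M ++ r) a b | None, None => true | _, _ => false
    end.
  rewrite mem_cat => /orP[/stM | /mapP[[a b] ab [-> ->]] /=].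
    by case: (h x) (h y) => [a|] [b|] // /MMr.
  by apply: linked_edge; rewrite mem_cat ab orbT.
case: existsP => [[j0 /eqP fj0]|nof].
  rewrite add1n -ncomp_isolated.
  pose g (o : option I) : I + J := if o is Some i then inl i else inr j0.
  apply: (@ncomp_equiv _ _ _ _ h g).
  - move=> x y /hG; case: (h x) (h y) => [a|] [b|] //; first exact: linked_image.
    by rewrite /linked connect0.
  - by move=> _ _ /mapP[[a b] ab [-> ->]] /=; apply: MG.
  - case=> [i|j] /=; first by rewrite /linked connect0.
    by apply: stG; case fj: (f j) => [i|]; [apply: fS | apply: fN].
  - by case=> [i|]; rewrite /= ?fj0 /linked connect0.
rewrite add0n.
have hS x : exists i, h x == Some i.
  case: x => [i|j] /=; first by exists i.
  by case fj: (f j) => [i|]; [exists i | case: nof; exists j; rewrite fj].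
pose h' (x : I + J) := xchoose (hS x).
have hh' x : h x = Some (h' x) by apply/eqP; exact: (xchooseP (hS x)).
apply: (@ncomp_equiv _ _ _ _ h' inl).
- by move=> x y /hG; rewrite !hh'.
- exact: MG.
- case=> [i|j]; last by apply: stG; apply: fS; rewrite -[RHS]hh'.
  by have [<-] := hh' (inl i); rewrite /linked connect0.
- by move=> i; have [<-] := hh' (inl i); rewrite /linked connect0.
Qed.

(** ** Computing with numbered edges

    The edges of a tangle are numbered, its ends coming first.  All that is
    needed about its smoothings is then decided by computation. *)

Definition reach_step (l : seq (nat * nat)) (s : seq nat) : seq nat :=
  undup (s ++ [seq p.2 | p <- l & p.1 \in s] ++ [seq p.1 | p <- l & p.2 \in s]).

Definition reaches (l : seq (nat * nat)) (a b : nat) : bool :=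
  b \in iter (size l) (reach_step l) [:: a].

Lemma reachesP (T : finType) (v : nat -> T) l a b :
  reaches l a b -> linked (map (map_edge v) l) (v a) (v b).
Proof.
rewrite /reaches; elim: (size l) b => [|n IHn] b /=.
  by rewrite inE => /eqP ->; rewrite /linked connect0.
rewrite mem_undup !mem_cat => /or3P[/IHn //||];
  case/mapP=> -[x y]; rewrite mem_filter => /andP[/= /IHn ax xy] ->;
  have := linked_edge (mem_map_edge v xy); last rewrite linked_sym;
  exact: connect_trans.
Qed.

(** Listed in a fixed order, so that two states joining the ends in the same way
    give equal lists. *)
Definition matching (n : nat) (l : seq (nat * nat)) : seq (nat * nat) :=
  [seq p <- allpairs pair (iota 0 n) (iota 0 n) | (p.1 < p.2) && reaches l p.1 p.2].

Definition end_of (n : nat) (l : seq (nat * nat)) (c : nat) : option nat :=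
  if c < n then Some c else ohead [seq e <- iota 0 n | reaches l c e].

(** Every state considered below closes up at most one circle inside the disk,
    as [state_ok] checks. *)
Definition circles (n k : nat) (l : seq (nat * nat)) : nat :=
  has (fun c => end_of n l c == None) (iota n k).

(** The graph search is only proved sound, not complete; what its negative
    answers are used for is checked here on each state. *)
Definition state_ok (n k : nat) (l : seq (nat * nat)) : bool :=
  all (fun c => all (fun c' =>
    (end_of n l c == None) && (end_of n l c' == None) ==> reaches l c c')
    (iota n k)) (iota n k)
  && all (fun p => match end_of n l p.1, end_of n l p.2 with
       | Some a, Some b => reaches (matching n l) a b
       | None, None => true
       | _, _ => false
       end) l.

Lemma ncomp_state (I J : finType) (n k : nat) (bd : nat -> I) (v : nat -> I + J)
    (code : J -> nat) (l : seq (nat * nat)) (r : seq (I * I)) :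
    (forall c, c < n -> v c = inl (bd c)) ->
    (forall j, code j \in iota n k /\ v (code j) = inr j) ->
    (forall c, c \in iota n k -> exists2 j, code j = c & v c = inr j) ->
    all (fun p => (p.1 < n + k) && (p.2 < n + k)) l -> state_ok n k l ->
  ncomp (map (map_edge v) l ++ map (map_edge inl) r) =
  circles n k l + ncomp (map (map_edge bd) (matching n l) ++ r).
Proof.
move=> v_bd codeP v_code l_lt /andP[/allP ok1 /allP ok2].
have endP c e : end_of n l c = Some e ->
    [/\ e < n & linked (map (map_edge v) l) (v c) (v e)].
  rewrite /end_of; case: ltnP => [cn [<-]|_]; first by rewrite /linked connect0.
  case def_s: [seq _ <- _ | _] => [//|e' s] /= [<-].
  have: e' \in e' :: s by rewrite mem_head.
  by rewrite -def_s mem_filter mem_iota => /andP[/(reachesP v) ? /andP[_ ?]].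
have iotaE c : (c \in iota n k) = (n <= c) && (c < n + k) by rewrite mem_iota.
pose f j := omap bd (end_of n l (code j)).
rewrite (@ncomp_contract _ _ _ (map (map_edge bd) (matching n l)) _ f); first last.
- move=> a b /mapP[[x y]]; rewrite mem_filter => /andP[/= /andP[_ xy]].
  case/allpairsP=> -[x' y'] [] /=; rewrite !mem_iota => x'n y'n [? ?]; subst x' y'.
  move=> [-> ->]; rewrite -!v_bd //; exact: reachesP.
- move=> x y /mapP[[a b] ab [-> ->]] /=.
  have hE c : c < n + k ->
      match v c with inl i => Some i | inr j => f j end = omap bd (end_of n l c).
    move=> cnk; case: (ltnP c n) => cn; first by rewrite v_bd // /end_of cn.
    by have [|j <- ->] := v_code c; rewrite // iotaE cn.
  have /andP[/= an bn] := allP l_lt _ ab; rewrite !hE //.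
  by move: (ok2 _ ab) => /=; case: (end_of n l a) (end_of n l b) => [a'|] [b'|] //=;
     exact: reachesP.
- move=> j j'; rewrite /f; have [cj vj] := codeP j; have [cj' vj'] := codeP j'.
  case ej: (end_of n l (code j)) => [//|]; case ej': (end_of n l (code j')) => [//|] _ _.
  have /allP/(_ _ cj') := ok1 _ cj; rewrite ej ej' /=.
  by move=> /(reachesP v); rewrite vj vj'.
- move=> j i; rewrite /f; case ej: (end_of n l (code j)) => [e|//] [<-].
  by have [en] := endP _ _ ej; rewrite (v_bd e) // (codeP j).2.
congr (nat_of_bool _ + _); apply/existsP/hasP => [[j]|[c]].
  rewrite /f; case ej: (end_of n l (code j)) => //= _.
  by exists (code j); [case: (codeP j) | rewrite ej].
by move=> /v_code[j <- _] ej; exists j; rewrite /f (eqP ej).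
Qed.

(** The states come in the order in which [skein] expands, so that they can be
    paired with [state_coefs]. *)
Fixpoint states (qs : seq (ends nat)) (l : seq (nat * nat)) : seq (seq (nat * nat)) :=
  if qs is q :: qs' then states qs' (vsplit q ++ l) ++ states qs' (hsplit q ++ l)
  else [:: l].

Definition state_table (n k : nat) (qs : seq (ends nat)) :=
  [seq (circles n k l, matching n l) | l <- states qs [::]].

Section Expansion.
Local Open Scope ring_scope.
Variables (R : comPzRingType) (d : R).

Fixpoint state_coefs (ab : seq (R * R)) : seq R :=
  if ab is p :: ab' then
    map ( *%R p.1) (state_coefs ab') ++ map ( *%R p.2) (state_coefs ab')
  else [:: 1].

Lemma size_state_coefs (ab : seq (R * R)) qs l :
  size ab = size qs -> size (state_coefs ab) = size (states qs l).
Proof.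
elim: ab qs l => [|p ab IHab] [|q qs] l //= [/IHab szE].
by rewrite !size_cat !size_map -!szE.
Qed.

(** The skein sum of a tangle is the combination of its end matchings listed by
    its table.  The table does not depend on the ring, the colours or the
    surroundings, so it can be computed once for all. *)
Lemma skein_states (I J : finType) (n k : nat) (bd : nat -> I) (v : nat -> I + J)
    (code : J -> nat) (qs : seq (ends nat)) (ab : seq (R * R)) (r : seq (I * I)) :
    (forall c, (c < n)%N -> v c = inl (bd c)) ->
    (forall j, code j \in iota n k /\ v (code j) = inr j) ->
    (forall c, c \in iota n k -> exists2 j, code j = c & v c = inr j) ->
    size ab = size qs ->
    all (fun l => all (fun p => (p.1 < n + k)%N && (p.2 < n + k)%N) l && state_ok n k l)
      (states qs [::]) ->
  skein d (zip (map (map_ends v) qs) ab) (map (map_edge inl) r) =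
  \sum_(x <- zip (state_coefs ab) (state_table n k qs))
     x.1 * d ^+ x.2.1 * d ^+ ncomp (map (map_edge bd) x.2.2 ++ r).
Proof.
move=> v_bd codeP v_code; rewrite /state_table.
rewrite -[map (map_edge inl) r]/(map (map_edge v) [::] ++ map (map_edge inl) r).
elim: qs ab [::] => [|q qs IHqs] [|p ab] l //= => [_|[sz]].
  rewrite andbT => /andP[l_lt okl]; rewrite big_seq1 mul1r -exprD.
  by rewrite (ncomp_state _ v_bd codeP v_code).
rewrite all_cat => /andP[ok1 ok2].
rewrite vsplit_map hsplit_map !catA -!map_cat !IHqs // map_cat zip_cat; last first.
  by rewrite !size_map; apply: size_state_coefs.
rewrite big_cat /=.
have sumZ (c : R) (us : seq R) (ts : seq (nat * seq (nat * nat))) :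
    \sum_(x <- zip (map ( *%R c) us) ts)
       x.1 * d ^+ x.2.1 * d ^+ ncomp (map (map_edge bd) x.2.2 ++ r) =
    c * \sum_(x <- zip us ts)
       x.1 * d ^+ x.2.1 * d ^+ ncomp (map (map_edge bd) x.2.2 ++ r).
  elim: us ts => [|u us IHus] [|t ts] /=; rewrite ?big_nil ?mulr0 //.
  by rewrite !big_cons IHus mulrDr !mulrA.
by rewrite !sumZ.
Qed.

End Expansion.

(** The nodes of the pictures of RIII and RII in the order of their definitions:
    the ends [s1], [s2] (and [s3]) come first, then [t1], [t2] (and [t3]), then
    the inner edges. *)
Definition triangle_ends : seq (ends nat) := [:: (0,1,6,7); (6,2,3,8); (7,8,4,5)].
Definition triangle'_ends : seq (ends nat) := [:: (1,2,7,8); (0,8,6,5); (6,7,3,4)].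
Definition bigon_ends : seq (ends nat) := [:: (0,1,4,5); (5,4,3,2)].

(** * Coloured nodes and their relations *)

Section Nodes.
Local Open Scope ring_scope.
Variables (X : Type) (R : comPzRingType) (d : R).

(** A crossing or vertex seen without orientation: which colours its four ends
    may carry, counterclockwise from the bottom left, and the coefficients of
    its vertical and horizontal smoothings. *)
Record node := Node {
  adm : X -> X -> X -> X -> bool;
  vcoef : X -> X -> X -> X -> R;
  hcoef : X -> X -> X -> X -> R
}.

Definition coefs (N : node) a b c e : R * R := (vcoef N a b c e, hcoef N a b c e).

(** A quarter turn: vertical smoothings become horizontal. *)
Definition turn (N : node) : node :=
  Node (fun a b c e => adm N b c e a) (fun a b c e => hcoef N b c e a)
       (fun a b c e => vcoef N b c e a).

Definition solvable (N : node) : Prop :=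
  (forall a b, exists c e, adm N a b c e) /\
  (forall a b c e c' e', adm N a b c e -> adm N a b c' e' -> c = c' /\ e = e').

(** The four turns cover the four pairs of neighbouring ends. *)
Definition determined (N : node) : Prop :=
  [/\ solvable N, solvable (turn N), solvable (turn (turn N))
    & solvable (turn (turn (turn N)))].

Lemma determined_turn N : determined N -> determined (turn N).
Proof. by case. Qed.

(** ** The Temperley-Lieb algebra on three strands

    An element lists its coordinates on 1, e1, e2, e1 e2 and e2 e1. *)
Definition tl3 := (R * R * R * R * R)%type.

Definition tl3_mul (x y : tl3) : tl3 :=
  let: (x0, x1, x2, x3, x4) := x in let: (y0, y1, y2, y3, y4) := y in
  (x0 * y0,
   x0 * y1 + x1 * (y0 + d * y1 + y4) + x3 * (y1 + d * y4),
   x0 * y2 + x2 * (y0 + d * y2 + y3) + x4 * (y2 + d * y3),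
   x0 * y3 + x1 * (y2 + d * y3) + x3 * (y0 + d * y2 + y3),
   x0 * y4 + x2 * (y1 + d * y4) + x4 * (y0 + d * y1 + y4)).

Lemma tl3_mulA x y z : tl3_mul x (tl3_mul y z) = tl3_mul (tl3_mul x y) z.
Proof.
case: x y z => [[[[x0 x1] x2] x3] x4] [[[[y0 y1] y2] y3] y4] [[[[z0 z1] z2] z3] z4].
by rewrite /tl3_mul; do 4?congr pair; ring.
Qed.

Definition tl3_one : tl3 := (1, 0, 0, 0, 0).
Definition at12 (p : R * R) : tl3 := (p.1, p.2, 0, 0, 0).
Definition at23 (p : R * R) : tl3 := (p.1, 0, p.2, 0, 0).

Lemma tl3_mul1 x : tl3_mul tl3_one x = x.
Proof.
by case: x => [[[[x0 x1] x2] x3] x4]; rewrite /tl3_mul /=; do 4?congr pair; ring.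
Qed.

Lemma tl3_mulr1 x : tl3_mul x tl3_one = x.
Proof.
by case: x => [[[[x0 x1] x2] x3] x4]; rewrite /tl3_mul /=; do 4?congr pair; ring.
Qed.

(** The coefficients of the two triangles agree on each of the five matchings of
    six ends.  This is the braid relation of [tl3_braid] in coordinates; [pij]
    belongs to strands i and j in the first picture, [qij] in the second. *)
Definition triangle_eq (p12 p13 p23 q12 q13 q23 : R * R) : Prop :=
  [/\ p12.1 * p13.1 * p23.1 = q12.1 * q13.1 * q23.1,
      p12.1 * p13.2 * p23.2 = q12.1 * q13.2 * q23.2,
      p12.2 * p13.2 * p23.1 = q12.2 * q13.2 * q23.1,
      p12.1 * p13.2 * p23.1 =
        q12.2 * q13.1 * q23.1 + q12.1 * q13.1 * q23.2
        + d * (q12.2 * q13.1 * q23.2) + q12.2 * q13.2 * q23.2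
    & p12.2 * p13.1 * p23.1 + p12.1 * p13.1 * p23.2
        + d * (p12.2 * p13.1 * p23.2) + p12.2 * p13.2 * p23.2 =
      q12.1 * q13.2 * q23.1].

Lemma tl3_braid p12 p13 p23 q12 q13 q23 :
  triangle_eq p12 p13 p23 q12 q13 q23 <->
  tl3_mul (tl3_mul (at12 p12) (at23 p13)) (at12 p23) =
  tl3_mul (tl3_mul (at23 q23) (at12 q13)) (at23 q12).
Proof.
have -> : tl3_mul (tl3_mul (at12 p12) (at23 p13)) (at12 p23) =
  (p12.1 * p13.1 * p23.1,
   p12.2 * p13.1 * p23.1 + p12.1 * p13.1 * p23.2
     + d * (p12.2 * p13.1 * p23.2) + p12.2 * p13.2 * p23.2,
   p12.1 * p13.2 * p23.1, p12.2 * p13.2 * p23.1, p12.1 * p13.2 * p23.2).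
  by rewrite /tl3_mul /at12 /at23; do 4?congr pair; ring.
have -> : tl3_mul (tl3_mul (at23 q23) (at12 q13)) (at23 q12) =
  (q12.1 * q13.1 * q23.1, q12.1 * q13.2 * q23.1,
   q12.2 * q13.1 * q23.1 + q12.1 * q13.1 * q23.2
     + d * (q12.2 * q13.1 * q23.2) + q12.2 * q13.2 * q23.2,
   q12.2 * q13.2 * q23.1, q12.1 * q13.2 * q23.2).
  by rewrite /tl3_mul /at12 /at23; do 4?congr pair; ring.
by split=> [[-> -> -> -> ->] // | [e1 e5 e4 e3 e2]]; split.
Qed.

(** The equation for delta says exactly that the product of [p] and [q] has no
    horizontal part. *)
Definition inverse_coefs (p q : R * R) : Prop :=
  [/\ p.1 * q.1 = 1, p.2 * q.2 = 1 & d = - (p.1 * q.2) - q.1 * p.2].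

Lemma at12_inverse p q : inverse_coefs p q -> tl3_mul (at12 q) (at12 p) = tl3_one.
Proof.
case=> p1 p2 dE; rewrite /tl3_mul /at12 /tl3_one.
have e1 : q.1 * p.1 = 1 by rewrite mulrC.
have e2 : q.1 * p.2 + q.2 * (p.1 + d * p.2 + 0) + 0 * (p.2 + d * 0) = 0.
  have -> : d * p.2 = - p.1 * (p.2 * q.2) - q.1 * p.2 * p.2 by rewrite dE; ring.
  have -> : q.1 * p.2 + q.2 * (p.1 + (- p.1 * (p.2 * q.2) - q.1 * p.2 * p.2) + 0)
            + 0 * (p.2 + d * 0) =
            (q.1 * p.2 + q.2 * p.1 * (1 - p.2 * q.2)) - q.1 * p.2 * (p.2 * q.2) by ring.
  by rewrite p2; ring.
by rewrite e1 e2; do 4?congr pair; ring.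
Qed.

Lemma at23_inverse p q : inverse_coefs p q -> tl3_mul (at23 p) (at23 q) = tl3_one.
Proof.
case=> p1 p2 dE; rewrite /tl3_mul /at23 /tl3_one.
have e2 : p.1 * q.2 + p.2 * (q.1 + d * q.2 + 0) + 0 * (q.2 + d * 0) = 0.
  have -> : d * q.2 = - p.1 * q.2 * q.2 - q.1 * (p.2 * q.2) by rewrite dE; ring.
  have -> : p.1 * q.2 + p.2 * (q.1 + (- p.1 * q.2 * q.2 - q.1 * (p.2 * q.2)) + 0)
            + 0 * (q.2 + d * 0) =
            (p.1 * q.2 + p.2 * q.1 * (1 - p.2 * q.2)) - p.1 * q.2 * (p.2 * q.2) by ring.
  by rewrite p2; ring.
by rewrite p1 e2; do 4?congr pair; ring.
Qed.

(** Multiply the braid relation by the inverses of the first factor on the left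
    and of the last factor on the right. *)
Lemma triangle_eq_swap p12 p13 p23 q12 q13 q23 p q :
    inverse_coefs p12 p -> inverse_coefs q12 q ->
  triangle_eq p12 p13 p23 q12 q13 q23 -> triangle_eq p q23 q13 q p23 p13.
Proof.
move=> /at12_inverse ip /at23_inverse iq /tl3_braid eqT; apply/tl3_braid.
rewrite -[RHS]tl3_mul1 -ip -!tl3_mulA; congr tl3_mul.
by rewrite !tl3_mulA eqT -!tl3_mulA iq tl3_mulr1.
Qed.

Definition swap_coefs (p : R * R) : R * R := (p.2, p.1).

(** A sixth of a turn exchanges the two pictures and permutes the five matchings;
    the nodes that change from horizontal to vertical position have their
    smoothings exchanged. *)
Lemma triangle_eq_turn p12 p13 p23 q12 q13 q23 :
  triangle_eq p12 p13 p23 q12 q13 q23 ->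
  triangle_eq q23 (swap_coefs q12) (swap_coefs q13) p23 (swap_coefs p12) (swap_coefs p13).
Proof.
case=> e1 e2 e3 e4 e5; split; rewrite /=.
- by transitivity (q12.2 * q13.2 * q23.1); [ring | rewrite -e3; ring].
- by transitivity (q12.1 * q13.1 * q23.1); [ring | rewrite -e1; ring].
- by transitivity (q12.1 * q13.2 * q23.2); [ring | rewrite -e2; ring].
- by transitivity (q12.1 * q13.2 * q23.1); [ring | rewrite -e5; ring].
- by transitivity (p12.1 * p13.2 * p23.1); [rewrite e4; ring | ring].
Qed.

(** The strands 1, 2, 3 run from [s1], [s2], [s3] to [t1], [t2], [t3].  By
    [determined] nodes the colours of the bottom ends determine all others, so
    stating the existence of two matching colourings above each bottom gives the
    bijection between the colourings of the two pictures. *)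
Definition hexagon (N12 N13 N23 : node) : Prop :=
  forall s1 s2 s3, exists t1 t2 t3 m1 m2 m3 n1 n2 n3,
  [/\ adm N12 s1 s2 m1 m2, adm N13 m1 s3 t1 m3 & adm N23 m2 m3 t2 t3] /\
  [/\ adm N23 s2 s3 n2 n3, adm N13 s1 n3 n1 t3 & adm N12 n1 n2 t1 t2] /\
  triangle_eq (coefs N12 s1 s2 m1 m2) (coefs N13 m1 s3 t1 m3) (coefs N23 m2 m3 t2 t3)
    (coefs N12 n1 n2 t1 t2) (coefs N13 s1 n3 n1 t3) (coefs N23 s2 s3 n2 n3).

(** [M] is [N] reflected in a horizontal line with inverse coefficients, so that
    [M] stacked on [N] reduces to two vertical strands. *)
Definition inverse (N M : node) : Prop :=
  forall a b c e, adm M e c b a = adm N a b c e /\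
    inverse_coefs (coefs N a b c e) (coefs M e c b a).

(** The bottom ends are now those of strands 2, 3 and of strand 1 read backward.
    The hypothesis is applied at the colour of [s1] found by following the second
    picture back from them. *)
Lemma hexagon_turn N12 N13 N23 : determined N12 -> determined N13 -> determined N23 ->
  hexagon N12 N13 N23 -> hexagon N23 (turn (turn (turn N12))) (turn (turn (turn N13))).
Proof.
move=> [[_ un12] _ _ [ex12 _]] [[_ un13] _ _ [ex13 _]] [[ex23 un23] _ _ _] hex s2 s3 t1.
have [n2 [n3 N23n]] := ex23 s2 s3.
have [t2 [n1 N12n]] := ex12 n2 t1.
have [t3 [s1 N13n]] := ex13 n3 n1.
have [t1' [t2' [t3' [m1 [m2 [m3 [n1' [n2' [n3' [[a1 a2 a3] [[b1 b2 b3] eqT]]]]]]]]]]] :=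
  hex s1 s2 s3.
have [? ?] := un23 _ _ _ _ _ _ N23n b1; subst n2' n3'.
have [? ?] := un13 _ _ _ _ _ _ N13n b2; subst n1' t3'.
have [? ?] := un12 _ _ _ _ _ _ N12n b3; subst t1' t2'.
exists t2, t3, s1, n2, n3, n1, m2, m3, m1; split; first by split.
split; first by split.
exact: triangle_eq_turn eqT.
Qed.

(** Undoing the crossing of strands 1 and 2 at the bottom of one picture and at
    the top of the other exchanges the two strands. *)
Lemma hexagon_swap12 N12 N13 N23 M :
    inverse N12 M -> determined N12 -> determined M ->
  hexagon N12 N13 N23 -> hexagon M N23 N13.
Proof.
move=> inv [[_ un12] _ _ _] [[exM _] _ _ _] hex r1 r2 s3.
have [s2 [s1 Ms]] := exM r1 r2.
have [t1 [t2 [t3 [m1 [m2 [m3 [n1 [n2 [n3 [[a1 a2 a3] [[b1 b2 b3] eqT]]]]]]]]]]] :=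
  hex s1 s2 s3.
have Ns : adm N12 s1 s2 r2 r1 by rewrite -(inv _ _ _ _).1.
have [? ?] := un12 _ _ _ _ _ _ Ns a1; subst r1 r2.
exists n2, n1, t3, s2, s1, n3, t2, t1, m3; split; first by split.
split; first by split; rewrite ?(inv _ _ _ _).1.
by apply: triangle_eq_swap eqT; apply: (inv _ _ _ _).2.
Qed.

(** Six sixths of a turn being the identity, five of them turn backward. *)
Lemma hexagon_turnV N12 N13 N23 : determined N12 -> determined N13 -> determined N23 ->
  hexagon N12 N13 N23 -> hexagon (turn N13) (turn N23) N12.
Proof.
move=> d1 d2 d3 /(hexagon_turn d1 d2 d3) h1.
have d1' : determined (turn (turn (turn N12))) by do 3!apply: determined_turn.
have d2' : determined (turn (turn (turn N13))) by do 3!apply: determined_turn.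
have d3' : determined (turn (turn (turn N23))) by do 3!apply: determined_turn.
have h2 := hexagon_turn d3 d1' d2' h1.
have h3 := hexagon_turn d2' d3' (determined_turn (determined_turn d1)) h2.
have h4 := hexagon_turn (determined_turn (determined_turn d1))
  (determined_turn (determined_turn d2)) (determined_turn (determined_turn d3)) h3.
exact: hexagon_turn (determined_turn (determined_turn d3)) (determined_turn d1)
  (determined_turn d2) h4.
Qed.

Lemma hexagon_swap23 N12 N13 N23 M : inverse N23 M ->
    determined N12 -> determined N13 -> determined N23 -> determined M ->
  hexagon N12 N13 N23 -> hexagon N13 N12 M.
Proof.
move=> inv d1 d2 d3 dM /(hexagon_turn d1 d2 d3) h1.
have d1' : determined (turn (turn (turn N12))) by do 3!apply: determined_turn.
have d2' : determined (turn (turn (turn N13))) by do 3!apply: determined_turn.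
have := hexagon_swap12 inv d3 dM h1.
exact: hexagon_turnV.
Qed.

(** Exchange strand 3 with strands 2 and 1 in turn: it is now the first strand,
    and a sixth of a turn makes it the third one again, read backward. *)
Lemma hexagon_flip3 N12 N13 N23 M13 M23 : inverse N13 M13 -> inverse N23 M23 ->
    determined N12 -> determined N13 -> determined N23 ->
    determined M13 -> determined M23 ->
  hexagon N12 N13 N23 ->
  hexagon N12 (turn (turn (turn M13))) (turn (turn (turn M23))).
Proof.
move=> inv1 inv2 d1 d2 d3 dM1 dM2 /(hexagon_swap23 inv2 d1 d2 d3 dM2).
move/(hexagon_swap12 inv1 d2 dM1); exact: hexagon_turn.
Qed.

(** Only the crossing of strands 2 and 3 is inverted here, so that strands 1 and 2
    may meet at a vertex; they exchange roles, one of them reversed. *)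
Lemma hexagon_quarter N12 N13 N23 M23 : inverse N23 M23 ->
    determined N12 -> determined N13 -> determined N23 -> determined M23 ->
  hexagon N12 N13 N23 ->
  hexagon (turn (turn (turn N12))) (turn (turn (turn M23))) (turn (turn N13)).
Proof.
move=> inv d1 d2 d3 dM /(hexagon_turn d1 d2 d3) h.
have d1' : determined (turn (turn (turn N12))) by do 3!apply: determined_turn.
have d2' : determined (turn (turn (turn N13))) by do 3!apply: determined_turn.
have := hexagon_swap12 inv d3 dM h.
exact: hexagon_turn.
Qed.

(** ** Bigons *)

Definition bigon_eq (p p' q q' : R * R) : Prop :=
  p.1 * p'.1 = q.1 * q'.1 /\
  p.1 * p'.2 + p.2 * p'.1 + d * (p.2 * p'.2) =
  q.1 * q'.2 + q.2 * q'.1 + d * (q.2 * q'.2).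

(** The two bigons have [N] below [N'] and [M] below [M']. *)
Definition exchange (N N' M M' : node) : Prop :=
  forall s1 s2, exists t1 t2 m1 m2 n1 n2,
  [/\ adm N s1 s2 m1 m2, adm N' m2 m1 t2 t1, adm M s1 s2 n1 n2 & adm M' n2 n1 t2 t1] /\
  bigon_eq (coefs N s1 s2 m1 m2) (coefs N' m2 m1 t2 t1)
           (coefs M s1 s2 n1 n2) (coefs M' n2 n1 t2 t1).

Lemma exchange_sym N N' M M' : exchange N N' M M' -> exchange M M' N N'.
Proof.
move=> ex s1 s2.
have [t1 [t2 [m1 [m2 [n1 [n2 [[a1 a2 a3 a4] [e1 e2]]]]]]]] := ex s1 s2.
by exists t1, t2, n1, n2, m1, m2; do 2!split.
Qed.

Lemma bigon_eq_sym p p' q q' : bigon_eq p p' q q' -> bigon_eq q q' p p'.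
Proof. by case. Qed.

Lemma bigon_eqC p p' q q' : bigon_eq p p' q q' -> bigon_eq p' p q' q.
Proof.
case=> e1 e2; split; first by rewrite mulrC e1 mulrC.
transitivity (p.1 * p'.2 + p.2 * p'.1 + d * (p.2 * p'.2)); first by ring.
by rewrite e2; ring.
Qed.

Lemma tl3_bigon p p' q q' :
  bigon_eq p p' q q' <->
  tl3_mul (at12 p) (at12 p') = tl3_mul (at12 q) (at12 q').
Proof.
have E x y : tl3_mul (at12 x) (at12 y) =
    at12 (x.1 * y.1, x.1 * y.2 + x.2 * y.1 + d * (x.2 * y.2)).
  by rewrite /tl3_mul /at12; do 4?congr pair => /=; ring.
by rewrite !E /at12 /bigon_eq /=; split=> [[-> ->] // | [-> ->]].
Qed.

Lemma inverse_coefs_sym p q : inverse_coefs p q -> inverse_coefs q p.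
Proof. by case=> e1 e2 e3; split; rewrite 1?mulrC // e3; ring. Qed.

Lemma bigon_eq_inverse p p' q q' P Q :
    inverse_coefs p P -> inverse_coefs q' Q ->
  bigon_eq p p' q q' -> bigon_eq p' Q P q.
Proof.
move=> /at12_inverse iP /inverse_coefs_sym/at12_inverse iQ /tl3_bigon e.
apply/tl3_bigon; rewrite -[LHS]tl3_mul1 -iP -!tl3_mulA; congr tl3_mul.
by rewrite !tl3_mulA e -!tl3_mulA iQ tl3_mulr1.
Qed.

(** Half a turn brings the upper node to the bottom. *)
Lemma exchange_turn N N' M M' : determined N -> determined N' -> exchange N N' M M' ->
  exchange (turn (turn N')) (turn (turn N)) (turn (turn M')) (turn (turn M)).
Proof.
move=> [[_ unN] _ [exN _] _] [[_ unN'] _ [exN' _] _] ex t2 t1.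
have [m2 [m1 N'm]] := exN' t2 t1; have [s1 [s2 Ns]] := exN m1 m2.
have [t1' [t2' [m1' [m2' [n1 [n2 [[a1 a2 a3 a4] e]]]]]]] := ex s1 s2.
have [? ?] := unN _ _ _ _ _ _ Ns a1; subst m1' m2'.
have [? ?] := unN' _ _ _ _ _ _ N'm a2; subst t1' t2'.
exists s2, s1, m2, m1, n2, n1; split; first by split.
exact: bigon_eqC e.
Qed.

(** Undo [C] at the bottom of the first picture and [C'] at the top of the
    second. *)
Lemma exchange_inverse C V V' C' M M' : inverse C M -> inverse C' M' ->
    determined C -> determined M -> exchange C V V' C' -> exchange V M' M V'.
Proof.
move=> inv inv' [[_ unC] _ _ _] [[exM _] _ _ _] ex r1 r2.
have [s2 [s1 Ms]] := exM r1 r2.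
have Cs : adm C s1 s2 r2 r1 by rewrite -(inv _ _ _ _).1.
have [t1 [t2 [m1 [m2 [n1 [n2 [[a1 a2 a3 a4] e]]]]]]] := ex s1 s2.
have [? ?] := unC _ _ _ _ _ _ Cs a1; subst r1 r2.
exists n2, n1, t2, t1, s2, s1; split.
  by split=> //; rewrite (inv' _ _ _ _).1.
by apply: bigon_eq_inverse e; [apply: (inv _ _ _ _).2 | apply: (inv' _ _ _ _).2].
Qed.

(** Joining two neighbouring ends of a triangle turns one of its crossings into
    a kink; what remains are the coefficients of three crossings on one side
    and of two crossings on the other. *)
Lemma triangle_eq_close_left p12 p13 p23 q12 k q23 :
    triangle_eq p12 p13 p23 q12 k q23 -> d * k.1 + k.2 = 1 ->
  q23.1 * q12.1 = d * (p12.1 * p13.1 * p23.1) + p12.2 * p13.1 * p23.1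
    + p12.1 * p13.1 * p23.2 + d * (p12.2 * p13.1 * p23.2) + p12.2 * p13.2 * p23.2 /\
  q23.1 * q12.2 + q23.2 * q12.1 + d * (q23.2 * q12.2) =
    d * (p12.1 * p13.2 * p23.1) + p12.1 * p13.2 * p23.2 + p12.2 * p13.2 * p23.1.
Proof.
case=> e1 e2 e3 e4 e5 k1; split.
  transitivity (q23.1 * q12.1 * (d * k.1 + k.2)); first by rewrite k1 mulr1.
  transitivity (d * (q12.1 * k.1 * q23.1) + q12.1 * k.2 * q23.1); first by ring.
  by rewrite -e1 -e5; ring.
transitivity ((q23.1 * q12.2 + q23.2 * q12.1 + d * (q23.2 * q12.2)) * (d * k.1 + k.2)).
  by rewrite k1 mulr1.
by rewrite e4 e2 e3; ring.
Qed.

Lemma triangle_eq_close_top p12 p13 k q12 q13 q23 :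
    triangle_eq p12 p13 k q12 q13 q23 -> k.1 + d * k.2 = 1 ->
  p12.1 * p13.2 = q12.2 * q13.1 * q23.1 + q12.1 * q13.1 * q23.2
    + d * (q12.2 * q13.1 * q23.2) + q12.2 * q13.2 * q23.2 + d * (q12.1 * q13.2 * q23.2) /\
  p12.1 * p13.1 + p12.2 * p13.2 + d * (p12.2 * p13.1) =
    q12.1 * q13.1 * q23.1 + d * (q12.1 * q13.2 * q23.1) + q12.2 * q13.2 * q23.1.
Proof.
case=> e1 e2 e3 e4 e5 k1; split.
  transitivity (p12.1 * p13.2 * (k.1 + d * k.2)); first by rewrite k1 mulr1.
  by rewrite -e4 -e2; ring.
transitivity ((p12.1 * p13.1 + p12.2 * p13.2 + d * (p12.2 * p13.1)) * (k.1 + d * k.2)).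
  by rewrite k1 mulr1.
by rewrite -e1 -e5 -e3; ring.
Qed.

(** Both sides of [bigon_eq] followed by one more crossing, in the form in
    which the two closures above produce them. *)
Lemma bigon_eq_bend m v c c' v' : bigon_eq v c c' v' ->
  d * (v.2 * m.1 * c.2) + v.1 * m.1 * c.2 + v.2 * m.1 * c.1
    + d * (v.1 * m.1 * c.1) + v.1 * m.2 * c.1 =
  v'.1 * c'.1 * m.2 + v'.2 * c'.1 * m.1 + d * (v'.1 * c'.1 * m.1)
    + v'.1 * c'.2 * m.1 + d * (v'.2 * c'.2 * m.1) /\
  d * (v.2 * m.2 * c.2) + v.2 * m.2 * c.1 + v.1 * m.2 * c.2 =
  v'.2 * c'.1 * m.2 + d * (v'.2 * c'.2 * m.2) + v'.1 * c'.2 * m.2.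
Proof.
case=> e1 e2; split.
  transitivity (m.1 * (v.1 * c.2 + v.2 * c.1 + d * (v.2 * c.2))
                + (m.2 + d * m.1) * (v.1 * c.1)); first by ring.
  by rewrite e1 e2; ring.
transitivity (m.2 * (v.1 * c.2 + v.2 * c.1 + d * (v.2 * c.2))); first by ring.
by rewrite e2; ring.
Qed.

(** Joining the left ends of [N], both coloured [m], gives the other two ends a
    common colour [c], and conversely on the right; the last equation is the
    value 1 of the kink.  Both directions are required because kinks are closed
    on either side. *)
Definition kink_node (N : node) : Prop :=
  [/\ forall m, exists c, adm N m c c m, forall c, exists m, adm N m c c m
    & forall m c, adm N m c c m -> d * vcoef N m c c m + hcoef N m c c m = 1].

(** [C] will be a positive crossing and [M] its inverse.  With [V] drawn upward,
    [C] is attached to its left ends.  The strand of [C] that passes over leaves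
    [V] at the top left; up to a kink it may instead go around the top of [V],
    crossing the top right end and then the bottom right one.  The first of these
    crossings slides to the bottom of [V] along parallel strands.  Then the strand
    leaving [V] at the bottom left passes under the two right ends, and by the
    other hexagon it may instead cross the top left end, up to a kink: this is
    [C] again, on the left of the turned [V]. *)
Lemma exchange_antiparallel C M V :
    determined C -> determined M -> determined V -> kink_node M -> exchange C V V C ->
    hexagon (turn V) (turn (turn M)) (turn (turn (turn C))) ->
    hexagon (turn (turn (turn V))) C (turn M) ->
  exchange (turn (turn (turn C))) (turn V) (turn (turn (turn V))) (turn C).
Proof.
move=> dC dM dV [kM kM' kM1] ex hexB hexA.
have [[_ unC] _ _ [exC3 unC3]] := dC.
have [[_ unM] [_ unM1] [_ unM2] [_ unM3]] := dM.
have [[_ unV] [exV1 unV1] _ [_ unV3]] := dV.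
move=> s1 s2.
have [m1 [m2 Cm]] := exC3 s1 s2.
have [t2 [t1 Vt]] := exV1 m2 m1.
have [c Mc] := kM m2.
(* [c] is the colour of the kink: the hexagon is closed up by joining [s1] to [t3]. *)
have [t1' [t2' [t3' [k1 [k2 [k3 [n1 [n2 [n3 [[a1 a2 a3] [[b1 b2 b3] eB]]]]]]]]]]] :=
  hexB c s1 s2.
have [? ?] := unC3 _ _ _ _ _ _ Cm b1; subst n2 n3.
have [? ?] := unM2 _ _ _ _ _ _ (Mc : adm (turn (turn M)) c m2 m2 c) b2; subst n1 t3'.
have [? ?] := unV1 _ _ _ _ _ _ Vt b3; subst t1' t2'.
have [u1 [u2 [v1 [v2 [w1 [w2 [[c1 c2 c3 c4] eC]]]]]]] := ex s1 k1.
have [? ?] := unV _ _ _ _ _ _ (a1 : adm V s1 k1 k2 c) c3; subst w1 w2.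
have [? ?] := unC _ _ _ _ _ _ (a3 : adm C c k2 k3 t1) c4; subst u1 u2.
(* Here the hexagon is closed up by joining [t2] to [t3], with kink colour [q]. *)
have [q Mq] := kM' v2.
have [y1 [y2 [y3 [h1 [h2 [h3 [z1 [z2 [z3 [[d1 d2 d3] [[f1 f2 f3] eA]]]]]]]]]]] :=
  hexA s1 s2 t2.
have [? ?] := unM1 _ _ _ _ _ _ (a2 : adm (turn M) s2 t2 k3 k1) f1; subst z2 z3.
have [? ?] := unC _ _ _ _ _ _ c1 f2; subst z1 y3.
have [? ?] := unV3 _ _ _ _ _ _ (c2 : adm (turn (turn (turn V))) v1 k3 t1 v2) f3; subst y1 y2.
have [? ?] := unM3 _ _ _ _ _ _ (Mq : adm (turn (turn (turn M))) v2 v2 q q) d3; subst h2 h3.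
exists t1, t2, m1, m2, h1, q; split; first by split.
have [B1 B2] := triangle_eq_close_left eB (kM1 _ _ Mc).
have kq : (coefs (turn M) q q v2 v2).1 + d * (coefs (turn M) q q v2 v2).2 = 1.
  by rewrite addrC; exact: kM1 Mq.
have [A1 A2] := triangle_eq_close_top eA kq.
have [C1 C2] := bigon_eq_bend (coefs M t2 k3 k1 s2) (bigon_eq_sym eC).
by split; [exact: etrans B1 (etrans C1 (esym A1)) | exact: etrans B2 (etrans C2 (esym A2))].
Qed.

Lemma inverse_sym (N M : node) : inverse N M -> inverse M N.
Proof.
move=> inv a b c e; have [admE co] := inv e c b a; split; first by rewrite admE.
exact: inverse_coefs_sym co.
Qed.

Lemma inverse_turn (N M : node) :
  inverse N M -> inverse (turn N) (turn (turn (turn M))).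
Proof.
move=> inv a b c e; have [admE [c1 c2 dE]] := inv b c e a; split; first exact: admE.
by split; rewrite /coefs /= in c1 c2 dE *; rewrite // dE; ring.
Qed.

Lemma determined_inverse (N M : node) : inverse N M -> determined N -> determined M.
Proof.
move=> inv [[ex0 un0] [ex1 un1] [ex2 un2] [ex3 un3]].
have admE a b c e : adm M a b c e = adm N e c b a by rewrite -(inv _ _ _ _).1.
split; split; rewrite /= => a b.
- by have [c [e h]] := ex2 b a; exists e, c; rewrite admE.
- by move=> c e c' e'; rewrite !admE => h1 h2; have [-> ->] := un2 _ _ _ _ _ _ h1 h2.
- by have [c [e h]] := ex1 b a; exists e, c; rewrite admE.
- by move=> c e c' e'; rewrite !admE => h1 h2; have [-> ->] := un1 _ _ _ _ _ _ h1 h2.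
- by have [c [e h]] := ex0 b a; exists e, c; rewrite admE.
- by move=> c e c' e'; rewrite !admE => h1 h2; have [-> ->] := un0 _ _ _ _ _ _ h1 h2.
- by have [c [e h]] := ex3 b a; exists e, c; rewrite admE.
- by move=> c e c' e'; rewrite !admE => h1 h2; have [-> ->] := un3 _ _ _ _ _ _ h1 h2.
Qed.

End Nodes.

Section OpNodes.
Local Open Scope ring_scope.
Variables (X : eqType) (R : comPzRingType) (d : R).

(** An upward node whose label pair is read at its left ends, the top one [e]
    first. *)
Definition op_node (u o : X -> X -> X) (v h : X -> X -> R) : node X R :=
  Node (fun a b c e => (b == u e a) && (c == o a e))
       (fun a _ _ e => v e a) (fun a _ _ e => h e a).

(** Left and right ends determine each other by the bijection of the
    psyquandle, the bottom and top ends by right invertibility. *)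
Lemma op_node_determined u o uV oV v h :
    right_inverse_of u uV -> right_inverse_of o oV ->
    bijective (fun p : X * X => (o p.2 p.1, u p.1 p.2)) ->
  determined (op_node u o v h).
Proof.
move=> uK oK [g gK Kg]; split; split; rewrite /=.
- by move=> a b; exists (o a (uV b a)), (uV b a); rewrite (uK _ _).2 !eqxx.
- move=> a b c e c' e' /andP[/eqP -> /eqP ->] /andP[/eqP eb /eqP ->].
  by have <- : e = e' by rewrite -(uK e a).1 eb (uK _ _).1.
- by move=> e a; exists (u e a), (o a e); rewrite !eqxx.
- by move=> e a b c b' c' /andP[/eqP -> /eqP ->] /andP[/eqP -> /eqP ->].
- by move=> c e; exists (oV c e), (u e (oV c e)); rewrite (oK _ _).2 !eqxx.
- move=> c e a b a' b' /andP[/eqP -> /eqP ->] /andP[/eqP -> /eqP ec].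
  by have <- : a = a' by rewrite -(oK a e).1 ec (oK _ _).1.
- move=> b c; exists (g (c, b)).1, (g (c, b)).2.
  by have := Kg (c, b); case: (g _) => e a /= [-> ->]; rewrite !eqxx.
- move=> b c e a e' a' /andP[/eqP eb /eqP ec] /andP[/eqP eb' /eqP ec'].
  have: (e, a) = (e', a') by rewrite -[LHS]gK -[RHS]gK /= -ec -eb -ec' -eb'.
  by case=> -> ->.
Qed.

(** Parametrized by the left edges [x], [y], [z] of the triangle, its
    colourings agree with those of the other triangle because of the three
    exchange laws. *)
Lemma op_hexagon u12 o12 v12 h12 u13 o13 v13 h13 u23 o23 v23 h23 :
    let N12 := op_node u12 o12 v12 h12 in
    let N13 := op_node u13 o13 v13 h13 in
    let N23 := op_node u23 o23 v23 h23 in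
    solvable N12 -> solvable N13 -> solvable N23 ->
    (forall x y z, u13 (u23 x y) (o12 z y) = u23 (u13 x z) (u12 y z)) ->
    (forall x y z, o23 (u12 y z) (u13 x z) = u12 (o23 y x) (o13 z x)) ->
    (forall x y z, o13 (o12 z y) (u23 x y) = o12 (o13 z x) (o23 y x)) ->
    (forall x y z, triangle_eq d
       (v12 y z, h12 y z) (v13 (u23 x y) (o12 z y), h13 (u23 x y) (o12 z y))
       (v23 x y, h23 x y)
       (v12 (o23 y x) (o13 z x), h12 (o23 y x) (o13 z x)) (v13 x z, h13 x z)
       (v23 (u13 x z) (u12 y z), h23 (u13 x z) (u12 y z))) ->
  hexagon d N12 N13 N23.
Proof.
move=> N12 N13 N23 [ex12 _] [ex13 _] [ex23 _] E1 E2 E3 eqT z s2 s3.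
have [m1 [y /andP[/eqP ? /eqP ?]]] := ex12 z s2; subst s2 m1.
have [t1 [m3 /andP[/eqP ? /eqP ?]]] := ex13 (o12 z y) s3; subst s3 t1.
have [t2 [x /andP[/eqP ? /eqP ?]]] := ex23 y m3; subst m3 t2.
exists (o13 (o12 z y) (u23 x y)), (o23 y x), x, (o12 z y), y, (u23 x y).
exists (o13 z x), (o23 (u12 y z) (u13 x z)), (u13 x z).
split; first by rewrite /= !eqxx.
split; first by rewrite /= E1 E2 E3 !eqxx.
by have := eqT x y z; rewrite /coefs /=; apply.
Qed.
End OpNodes.

(** * The nodes of a psyquandle bracket *)

Section BracketNodes.
Local Open Scope ring_scope.
Variables (X : finType) (Q : psyquandle X) (R : comPzRingType) (beta : bracket Q R).
Notation d := (bd beta).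

Definition upward_node (k : ckind) : node X R :=
  Node (fun a b c e => crossing_rule Q id (Crossing k a b e c))
       (fun a b c e => weight beta id (Crossing k a b e c) true)
       (fun a b c e => weight beta id (Crossing k a b e c) false).

(** Turned in the same way as [xc] turns its picture. *)
Definition xc_node (k : ckind) (ru rv : bool) : node X R :=
  let N := upward_node k in
  match ru, rv with
  | false, false => N
  | true, false => turn N
  | true, true => turn (turn N)
  | false, true => turn (turn (turn N))
  end.

(** These are the upward nodes up to conversion, in the form of [op_node]. *)
Definition positive_node : node X R :=
  op_node (ut Q) (ot Q) (fun x y => bwV beta * bA beta x y)
                        (fun x y => bwV beta * bB beta x y).

Definition vertex_node : node X R :=
  op_node (ub Q) (ob Q) (fun x y => 1 * bP beta x y) (fun x y => 1 * bS beta x y).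

Lemma positive_determined : determined (upward_node Positive).
Proof.
exact: (op_node_determined _ _ (utK Q) (otK Q) (tri_bij Q) : determined positive_node).
Qed.

Lemma vertex_determined : determined (upward_node Vertex).
Proof.
exact: (op_node_determined _ _ (ubK Q) (obK Q) (bul_bij Q) : determined vertex_node).
Qed.

(** In labels and colours, a negative crossing is a positive one reflected in a
    horizontal line. *)
Lemma positive_negative : inverse d (upward_node Positive) (upward_node Negative).
Proof.
move=> a b c e; split; first by rewrite /= /crossing_rule /= andbC.
have w1 := bw_unit beta.
have A1 := bA_unit beta e a; have B1 := bB_unit beta e a.
split; rewrite /= /weight /coefficient /=.
- transitivity ((bw beta * bwV beta) * (bA beta e a * bAV beta e a)); first by ring.
  by rewrite w1 A1 mulr1.
- transitivity ((bw beta * bwV beta) * (bB beta e a * bBV beta e a)); first by ring.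
  by rewrite w1 B1 mulr1.
rewrite -(bdE beta e a).
transitivity (- ((bw beta * bwV beta) * (bA beta e a * bBV beta e a))
              - (bw beta * bwV beta) * (bAV beta e a * bB beta e a)); last by ring.
by rewrite w1 !mul1r.
Qed.

Lemma xc_node_determined k ru rv : determined (xc_node k ru rv).
Proof.
have detN : determined (upward_node k).
  case: k; [exact: positive_determined | | exact: vertex_determined].
  exact: determined_inverse positive_negative positive_determined.
by case: ru rv => [] []; do ?[exact: detN | apply: determined_turn].
Qed.

Lemma xc_node_inverse o r1 r2 :
  inverse d (xc_node (csign o r1 r2) r1 r2) (xc_node (csign (~~ o) r2 r1) r2 r1).
Proof.
have inv (b : bool) : inverse d (upward_node (signed b)) (upward_node (signed (~~ b))).
  by case: b; [exact: positive_negative | apply: inverse_sym positive_negative].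
have -> : csign (~~ o) r2 r1 = signed (~~ (o (+) r1 (+) r2)).
  by case: o r1 r2 => [] [] [].
rewrite /xc_node /csign; move: (inv (o (+) r1 (+) r2)).
move: (upward_node _) (upward_node _) => N M iNM {inv}.
have i1 := inverse_turn iNM; have i2 := inverse_turn i1; have i3 := inverse_turn i2.
by case: r1 r2 => [] [].
Qed.

(** Finiteness of [X] is needed to find a kink with a given outer colour. *)
Lemma diagonal_onto (u o : X -> X -> X) :
    bijective (fun p : X * X => (o p.2 p.1, u p.1 p.2)) ->
    (forall x, u x x = o x x) ->
  forall c, exists x, u x x = c.
Proof.
move=> /bij_inj inj uo c.
have inj' : injective (fun x => u x x).
  move=> x y uxy; suff [] : (x, x) = (y, y) by [].
  by apply: inj; rewrite /= -!uo uxy.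
by have [g gK Kg] := injF_bij inj'; exists (g c).
Qed.

Lemma positive_kink : kink_node d (upward_node Positive).
Proof.
split=> [m|c|m c _].
- by exists (ut Q m m); rewrite /= /crossing_rule /= tri_diag !eqxx.
- have [x <-] := diagonal_onto (tri_bij Q) (tri_diag Q) c.
  by exists x; rewrite /= /crossing_rule /= tri_diag !eqxx.
rewrite /= /weight /coefficient /=.
have w1 := bw_unit beta; have A1 := bA_unit beta m m.
rewrite -(bdE beta m m).
transitivity (bwV beta * (- (bA beta m m ^+ 2 * bBV beta m m)
               + bB beta m m * (1 - bA beta m m * bAV beta m m))); first by ring.
by rewrite A1 bwE subrr mulr0 addr0 mulrC.
Qed.

Lemma negative_kink : kink_node d (upward_node Negative).
Proof.
split=> [m|c|m c _].
- by exists (ut Q m m); rewrite /= /crossing_rule /= tri_diag !eqxx.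
- have [x <-] := diagonal_onto (tri_bij Q) (tri_diag Q) c.
  by exists x; rewrite /= /crossing_rule /= tri_diag !eqxx.
rewrite /= /weight /coefficient /=.
have A1 := bA_unit beta m m; have B1 := bB_unit beta m m.
rewrite -(bdE beta m m) -(bwE beta m).
set A := bA beta m m; set B := bB beta m m.
set AV := bAV beta m m; set BV := bBV beta m m.
transitivity (A * AV * (A * AV) * (B * BV)
              + A ^+ 2 * BV * BV * (A * AV - 1)); first by ring.
by rewrite A1 B1 subrr mulr0 !mulr1 addr0.
Qed.

Lemma vertex_kink : pI_adequate Q -> pI_adequate_bracket beta ->
  kink_node d (upward_node Vertex).
Proof.
move=> adQ adb; split=> [m|c|m c _].
- by exists (ub Q m m); rewrite /= /crossing_rule /= adQ !eqxx.
- have [x <-] := diagonal_onto (bul_bij Q) adQ c.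
  by exists x; rewrite /= /crossing_rule /= adQ !eqxx.
by rewrite /= /weight /coefficient /= !mul1r adb.
Qed.

Lemma scaled_eq (c l r x y : R) : l = r -> x = c * l -> y = c * r -> x = y.
Proof. by move=> -> -> ->. Qed.

Lemma upward_RIII : hexagon d positive_node positive_node positive_node.
Proof.
have [sol _ _ _] := positive_determined.
apply: (op_hexagon sol sol sol).
- by move=> x y z; rewrite -exchange1.
- by move=> x y z; rewrite exchange2.
- by move=> x y z; rewrite exchange3.
move=> x y z; split; rewrite /=.
- by apply: (scaled_eq (c := bwV beta ^+ 3) (rIII1 beta x y z)); ring.
- by apply: (scaled_eq (c := bwV beta ^+ 3) (rIII3 beta x y z)); ring.
- by apply: (scaled_eq (c := bwV beta ^+ 3) (rIII2 beta x y z)); ring.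
- by apply: (scaled_eq (c := bwV beta ^+ 3) (rIII4 beta x y z)); ring.
by apply: (scaled_eq (c := bwV beta ^+ 3) (rIII5 beta x y z)); ring.
Qed.

Lemma upward_pIII_under : hexagon d vertex_node positive_node positive_node.
Proof.
have [sol _ _ _] := positive_determined; have [solV _ _ _] := vertex_determined.
apply: (op_hexagon solV sol sol).
- by move=> x y z; rewrite slide2.
- by move=> x y z; rewrite slide5.
- by move=> x y z; rewrite slide3.
move=> x y z; split; rewrite /=.
- by apply: (scaled_eq (c := bwV beta ^+ 2) (rpIII1 beta x y z)); ring.
- by apply: (scaled_eq (c := bwV beta ^+ 2) (rpIII3 beta x y z)); ring.
- by apply: (scaled_eq (c := bwV beta ^+ 2) (rpIII2 beta x y z)); ring.
- by apply: (scaled_eq (c := bwV beta ^+ 2) (rpIII4 beta x y z)); ring.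
by apply: (scaled_eq (c := bwV beta ^+ 2) (rpIII5 beta x y z)); ring.
Qed.

Lemma upward_pIII_over : hexagon d positive_node positive_node vertex_node.
Proof.
have [sol _ _ _] := positive_determined; have [solV _ _ _] := vertex_determined.
apply: (op_hexagon sol sol solV).
- by move=> x y z; rewrite -slide4.
- by move=> x y z; rewrite slide6.
- by move=> x y z; rewrite -slide1.
move=> x y z; split; rewrite /=.
- by apply: (scaled_eq (c := bwV beta ^+ 2) (rpIII6 beta x y z)); ring.
- by apply: (scaled_eq (c := bwV beta ^+ 2) (rpIII7 beta x y z)); ring.
- by apply: (scaled_eq (c := bwV beta ^+ 2) (rpIII8 beta x y z)); ring.
- by apply: (scaled_eq (c := bwV beta ^+ 2) (rpIII9 beta x y z)); ring.
by apply: (scaled_eq (c := bwV beta ^+ 2) (rpIII10 beta x y z)); ring.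
Qed.

(** The axioms are parametrized by the colours [x] and [y] of the left edges of
    the second picture; [y] is recovered from the first picture by right
    invertibility. *)
Lemma upward_pII : exchange d positive_node vertex_node vertex_node positive_node.
Proof.
have [[exP _] _ _ _] := positive_determined.
have [[exV _] _ _ _] := vertex_determined.
move=> u s2.
have [m1 [v Pv]] := exP u s2; have [t2 [x Vx]] := exV v m1.
move: Pv Vx => /andP[/eqP /= s2E /eqP /= m1E] /andP[/eqP /= m1E' /eqP /= t2E].
pose y := otV Q t2 x.
have yE : ot Q y x = t2 by rewrite (otK Q t2 x).2.
have vE : v = obV Q (ot Q y x) x by rewrite yE t2E (obK Q v x).1.
have uE : u = obV Q (ut Q x y) y.
  have := mixed1 Q x y; rewrite -vE -m1E' m1E => /(congr1 (fun a => otV Q a v)).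
  by rewrite !(otK Q _ v).1.
have oE : ob Q u y = ut Q x y by rewrite uE (obK Q _ y).2.
have e1 := rpII1 beta x y; have e2 := rpII2 beta x y.
rewrite /= -vE -uE in e1 e2.
exists x, t2, m1, v, (ut Q x y), y; split; split; rewrite /=.
- by rewrite s2E m1E !eqxx.
- by rewrite m1E' t2E !eqxx.
- have := mixed2 Q x y; rewrite -vE -uE => ->.
  by rewrite oE s2E !eqxx.
- by rewrite yE !eqxx.
- by apply: (scaled_eq (c := bwV beta) (esym e1)); ring.
by apply: (scaled_eq (c := bwV beta) (esym e2)); ring.
Qed.

(** ** All orientations *)

Lemma turn4 (N : node X R) : turn (turn (turn (turn N))) = N.
Proof. by case: N. Qed.

(** Reversing a strand and renaming it as the second one turns the picture. *)
Lemma turn_xc_node k r1 r2 :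
  turn (turn (turn (xc_node k r1 r2))) = xc_node k r2 (~~ r1).
Proof. by case: r1 r2 => [] []; rewrite /= ?turn4. Qed.

(** [oij] tells that strand i passes over strand j. *)
Definition hexagon_RIII (o12 o13 o23 r1 r2 r3 : bool) : Prop :=
  hexagon d (xc_node (csign o12 r1 r2) r1 r2) (xc_node (csign o13 r1 r3) r1 r3)
            (xc_node (csign o23 r2 r3) r2 r3).

Lemma RIII_swap12 o12 o13 o23 r1 r2 r3 :
  hexagon_RIII o12 o13 o23 r1 r2 r3 -> hexagon_RIII (~~ o12) o23 o13 r2 r1 r3.
Proof.
by apply: hexagon_swap12; first exact: xc_node_inverse; apply: xc_node_determined.
Qed.

Lemma RIII_swap23 o12 o13 o23 r1 r2 r3 :
  hexagon_RIII o12 o13 o23 r1 r2 r3 -> hexagon_RIII o13 o12 (~~ o23) r1 r3 r2.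
Proof.
by apply: hexagon_swap23; first exact: xc_node_inverse; apply: xc_node_determined.
Qed.

Lemma csign_flip o r1 r2 : csign (~~ o) r2 r1 = csign o r1 (~~ r2).
Proof. by case: o r1 r2 => [] [] []. Qed.

Lemma RIII_flip3 o12 o13 o23 r1 r2 r3 :
  hexagon_RIII o12 o13 o23 r1 r2 r3 -> hexagon_RIII o12 o13 o23 r1 r2 (~~ r3).
Proof.
rewrite /hexagon_RIII -!csign_flip -!turn_xc_node.
by apply: hexagon_flip3; try exact: xc_node_inverse; apply: xc_node_determined.
Qed.

(** The excluded cases are those where each strand passes over one other. *)
Lemma xc_node_RIII (o12 o13 o23 r1 r2 r3 : bool) :
    ~~ [&& o12, ~~ o13 & o23] -> ~~ [&& ~~ o12, o13 & ~~ o23] ->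
  hexagon_RIII o12 o13 o23 r1 r2 r3.
Proof.
move=> nc1 nc2.
have flip2 o o' o'' r r' r'' :
    hexagon_RIII o o' o'' r r' r'' -> hexagon_RIII o o' o'' r (~~ r') r''.
  by move=> /RIII_swap23/RIII_flip3/RIII_swap23; rewrite negbK.
have flip1 o o' o'' r r' r'' :
    hexagon_RIII o o' o'' r r' r'' -> hexagon_RIII o o' o'' (~~ r) r' r''.
  by move=> /RIII_swap12/flip2/RIII_swap12; rewrite negbK.
have: hexagon_RIII o12 o13 o23 false false false.
  have h111 : hexagon_RIII true true true false false false by exact: upward_RIII.
  have h011 := RIII_swap12 h111; have h110 := RIII_swap23 h111.
  have h001 := RIII_swap12 h110; have h100 := RIII_swap23 h011.
  have h000 := RIII_swap12 h100.
  by case: o12 o13 o23 nc1 nc2 => [] [] [].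
by case: r1 => [/flip1|]; case: r2 => [/flip2|]; case: r3 => [/RIII_flip3|].
Qed.

Definition hexagon_pIII (o r1 r2 r3 : bool) : Prop :=
  hexagon d (xc_node Vertex r1 r2) (xc_node (csign o r1 r3) r1 r3)
            (xc_node (csign o r2 r3) r2 r3).

Lemma pIII_flip3 o r1 r2 r3 : hexagon_pIII o r1 r2 r3 -> hexagon_pIII o r1 r2 (~~ r3).
Proof.
rewrite /hexagon_pIII -!csign_flip -!turn_xc_node.
by apply: hexagon_flip3; try exact: xc_node_inverse; apply: xc_node_determined.
Qed.

(** The vertex strands exchange roles, so that repeating this reverses either of
    them. *)
Lemma pIII_quarter o r1 r2 r3 :
  hexagon_pIII o r1 r2 r3 -> hexagon_pIII o r2 (~~ r1) (~~ r3).
Proof.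
have inv := xc_node_inverse o r2 r3.
move/(hexagon_quarter inv (xc_node_determined _ _ _) (xc_node_determined _ _ _)
  (xc_node_determined _ _ _) (xc_node_determined _ _ _)).
rewrite !turn_xc_node csign_flip /hexagon_pIII {inv}.
have -> : csign o (~~ r1) (~~ r3) = csign o r1 r3 by case: o r1 r3 => [] [] [].
by case: r1 r3 => [] []; rewrite /= ?turn4.
Qed.

Lemma xc_node_pIII o r1 r2 r3 : hexagon_pIII o r1 r2 r3.
Proof.
have: hexagon_pIII o false false false.
  case: o; first exact: upward_pIII_under.
  (* The axiom has the overcrossing strand first: move it past the two others. *)
  have dP := xc_node_determined Positive false false.
  have dN := xc_node_determined Negative false false.
  have dV := xc_node_determined Vertex false false.
  have := hexagon_swap12 positive_negative dP dN upward_pIII_over.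
  exact: (hexagon_swap23 positive_negative dN dV dP dN).
move=> h00; have h01 := pIII_quarter h00; have h11 := pIII_quarter h01.
have h10 := pIII_quarter h11; move: h00 h01 h11 h10.
by case: r1 r2 r3 => [] [] [] h00 h01 h11 h10 //; apply: (@pIII_flip3 _ _ _ true) ||
   apply: (@pIII_flip3 _ _ _ false).
Qed.

Definition exchange_pII (s r1 r2 : bool) : Prop :=
  exchange d (xc_node (signed s) r1 r2) (xc_node Vertex r2 r1)
             (xc_node Vertex r1 r2) (xc_node (signed s) r2 r1).

(** Reversing all strands reduces one of the two antiparallel cases to the other. *)
Lemma positive_pII r1 r2 : exchange_pII true r1 r2.
Proof.
have dP := xc_node_determined Positive false false.
have dN := xc_node_determined Negative false false.
have dV := xc_node_determined Vertex false false.
have ex00 : exchange_pII true false false by exact: upward_pII.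
have ex11 : exchange_pII true true true.
  by apply: exchange_sym; apply: exchange_turn ex00.
case: r1 r2 => [] [] //; last first.
  exact: (exchange_antiparallel dP dN dV negative_kink ex00
           (xc_node_pIII false true false true) (xc_node_pIII true false true false)).
have := exchange_antiparallel (determined_turn (determined_turn dP))
  (determined_turn (determined_turn dN)) (determined_turn (determined_turn dV)) _ ex11.
rewrite !turn4; apply.
- by have [k1 k2 k3] := negative_kink; split=> // m c; apply: k3.
- exact: (xc_node_pIII false false true false).
exact: (xc_node_pIII true true false true).
Qed.

Lemma xc_node_pII s r1 r2 : exchange_pII s r1 r2.
Proof.
case: s; first exact: positive_pII.
have inv t1 t2 : inverse d (xc_node Positive t1 t2) (xc_node Negative t2 t1).
  have := xc_node_inverse (~~ (t1 (+) t2)) t1 t2.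
  have -> : csign (~~ (t1 (+) t2)) t1 t2 = Positive by case: t1 t2 => [] [].
  by have -> : csign (~~ ~~ (t1 (+) t2)) t2 t1 = Negative by case: t1 t2 => [] [].
apply: exchange_sym.
exact: (exchange_inverse (inv r2 r1) (inv r1 r2) (xc_node_determined _ _ _)
  (xc_node_determined _ _ _) (positive_pII r2 r1)).
Qed.
End BracketNodes.

(** * Replacing the content of a disk *)

Section TangleSkein.
Local Open Scope ring_scope.
Variables (R : comPzRingType) (d : R) (I : finType).

Lemma triangle_skein (s1 t1 s2 t2 s3 t3 : I) (p12 p13 p23 q12 q13 q23 : R * R) r :
  let m1 : I + 'I_3 := inr (@Ordinal 3 0 isT) in
  let m2 : I + 'I_3 := inr (@Ordinal 3 1 isT) in
  let m3 : I + 'I_3 := inr (@Ordinal 3 2 isT) in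
  triangle_eq d p12 p13 p23 q12 q13 q23 ->
  skein d [:: ((inl s1, inl s2, m1, m2), p12); ((m1, inl s3, inl t1, m3), p13);
              ((m2, m3, inl t2, inl t3), p23)] (map (map_edge inl) r) =
  skein d [:: ((inl s2, inl s3, m2, m3), q23); ((inl s1, m3, m1, inl t3), q13);
              ((m1, m2, inl t1, inl t2), q12)] (map (map_edge inl) r).
Proof.
move=> m1 m2 m3 eqT.
pose bd := nth s1 [:: s1; s2; s3; t1; t2; t3].
pose v := nth (inl s1) [:: inl s1; inl s2; inl s3; inl t1; inl t2; inl t3; m1; m2; m3].
pose code (j : 'I_3) := (6 + j)%N.
have v_bd c : (c < 6)%N -> v c = inl (bd c) by move: c; do 6!case=> //.
have codeP j : code j \in iota 6 3 /\ v (code j) = inr j.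
  by case: j => -[|[|[|//]]] j3; split=> //; congr inr; apply: val_inj.
have v_code c : c \in iota 6 3 -> exists2 j, code j = c & v c = inr j.
  rewrite !inE => /or3P[] /eqP ->.
  - by exists (@Ordinal 3 0 isT).
  - by exists (@Ordinal 3 1 isT).
  by exists (@Ordinal 3 2 isT).
have := skein_states (qs := triangle_ends) (ab := [:: p12; p13; p23]) d r
  v_bd codeP v_code erefl isT.
have := skein_states (qs := triangle'_ends) (ab := [:: q23; q13; q12]) d r
  v_bd codeP v_code erefl isT.
have -> : state_table 6 3 triangle_ends =
  [:: (0, [:: (0, 5); (1, 4); (2, 3)]); (0, [:: (0, 1); (2, 3); (4, 5)]);
      (0, [:: (0, 5); (1, 2); (3, 4)]); (0, [:: (0, 3); (1, 2); (4, 5)]);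
      (0, [:: (0, 1); (2, 3); (4, 5)]); (1, [:: (0, 1); (2, 3); (4, 5)]);
      (0, [:: (0, 1); (2, 5); (3, 4)]); (0, [:: (0, 1); (2, 3); (4, 5)])]%N.
  by vm_compute.
have -> : state_table 6 3 triangle'_ends =
  [:: (0, [:: (0, 5); (1, 4); (2, 3)]); (0, [:: (0, 5); (1, 2); (3, 4)]);
      (0, [:: (0, 1); (2, 3); (4, 5)]); (0, [:: (0, 1); (2, 5); (3, 4)]);
      (0, [:: (0, 5); (1, 2); (3, 4)]); (1, [:: (0, 5); (1, 2); (3, 4)]);
      (0, [:: (0, 3); (1, 2); (4, 5)]); (0, [:: (0, 5); (1, 2); (3, 4)])]%N.
  by vm_compute.
rewrite [zip (state_coefs _) _]/= [zip (state_coefs _) _]/=.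
rewrite !big_cons !big_nil; cbn [fst snd].
set n1 := ncomp _; set n2 := ncomp _; set n3 := ncomp _; set n4 := ncomp _.
set n5 := ncomp _; move: n1 n2 n3 n4 n5 => n1 n2 n3 n4 n5.
move: (d ^+ n1) (d ^+ n2) (d ^+ n3) (d ^+ n4) (d ^+ n5) => z1 z2 z3 z4 z5.
move=> eq' eq; case: eqT => e1 e2 e3 e4 e5; rewrite [LHS]eq [RHS]eq' {eq eq'}.
transitivity (p12.1 * p13.1 * p23.1 * z1 +
  (p12.2 * p13.1 * p23.1 + p12.1 * p13.1 * p23.2
   + d * (p12.2 * p13.1 * p23.2) + p12.2 * p13.2 * p23.2) * z3 +
  p12.1 * p13.2 * p23.1 * z2 + p12.1 * p13.2 * p23.2 * z5 +
  p12.2 * p13.2 * p23.1 * z4); first by ring.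
by rewrite e1 e2 e3 e4 e5; ring.
Qed.

Lemma bigon_skein (s1 t1 s2 t2 : I) (p q : R * R) r :
  let m1 : I + 'I_2 := inr (@Ordinal 2 0 isT) in
  let m2 : I + 'I_2 := inr (@Ordinal 2 1 isT) in
  skein d [:: ((inl s1, inl s2, m1, m2), p); ((m2, m1, inl t2, inl t1), q)]
    (map (map_edge inl) r) =
  p.1 * q.1 * d ^+ ncomp ([:: (s1, t1); (s2, t2)] ++ r) +
  (p.1 * q.2 + p.2 * q.1 + d * (p.2 * q.2)) * d ^+ ncomp ([:: (s1, s2); (t1, t2)] ++ r).
Proof.
move=> m1 m2.
pose bd := nth s1 [:: s1; s2; t1; t2].
pose v := nth (inl s1) [:: inl s1; inl s2; inl t1; inl t2; m1; m2].
pose code (j : 'I_2) := (4 + j)%N.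
have v_bd c : (c < 4)%N -> v c = inl (bd c) by move: c; do 4!case=> //.
have codeP j : code j \in iota 4 2 /\ v (code j) = inr j.
  by case: j => -[|[|//]] j3; split=> //; congr inr; apply: val_inj.
have v_code c : c \in iota 4 2 -> exists2 j, code j = c & v c = inr j.
  rewrite !inE => /orP[] /eqP ->; first by exists (@Ordinal 2 0 isT).
  by exists (@Ordinal 2 1 isT).
have := skein_states (qs := bigon_ends) (ab := [:: p; q]) d r v_bd codeP v_code erefl isT.
have -> : state_table 4 2 bigon_ends =
  [:: (0, [:: (0, 2); (1, 3)]); (0, [:: (0, 1); (2, 3)]);
      (0, [:: (0, 1); (2, 3)]); (1, [:: (0, 1); (2, 3)])]%N.
  by vm_compute.
rewrite [zip (state_coefs _) _]/= !big_cons big_nil; cbn [fst snd].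
move=> eq; rewrite [LHS]eq /=.
set n1 := ncomp _; set n2 := ncomp _; move: n1 n2 => n1 n2.
by move: (d ^+ n1) (d ^+ n2) => z1 z2; ring.
Qed.

Lemma kink_skein (a b : I) (p : R * R) (left : bool) r :
  let m : I + unit := inr tt in
  skein d [:: (if left then (m, inl a, inl b, m) else (inl a, m, m, inl b), p)]
    (map (map_edge inl) r) =
  (d * p.1 + p.2) * d ^+ ncomp ((a, b) :: r).
Proof.
move=> m.
pose bd := nth a [:: a; b].
pose v := nth (inl a) [:: inl a; inl b; m].
pose code (j : unit) := 2%N.
have v_bd c : (c < 2)%N -> v c = inl (bd c) by move: c; do 2!case=> //.
have codeP j : code j \in iota 2 1 /\ v (code j) = inr j by case: j.
have v_code c : c \in iota 2 1 -> exists2 j, code j = c & v c = inr j.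
  by rewrite inE => /eqP ->; exists tt.
pose qs := [:: if left then (2, 0, 1, 2) else (0, 2, 2, 1)]%N.
have ok : all (fun l => all (fun p => (p.1 < 2 + 1)%N && (p.2 < 2 + 1)%N) l
    && state_ok 2 1 l) (states qs [::]) by rewrite /qs; case: (left); vm_compute.
have := skein_states (qs := qs) (ab := [:: p]) d r v_bd codeP v_code erefl ok.
have -> : state_table 2 1 qs = [:: (1, [:: (0, 1)]); (0, [:: (0, 1)])]%N.
  by rewrite /qs; case: (left); vm_compute.
rewrite [zip (state_coefs _) _]/= !big_cons big_nil; cbn [fst snd].
rewrite /qs; case: (left) => eq; rewrite [LHS]eq /=;
set n := ncomp _; move: n => n; move: (d ^+ n) => z; ring.
Qed.

Lemma arcs_skein (r r' : seq (I * I)) :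
  skein d [::] (map (map_edge (@inl I void)) r ++ map (map_edge inl) r') =
  d ^+ ncomp (r' ++ r).
Proof.
rewrite -map_cat /=; congr (_ ^+ _).
transitivity (ncomp (r ++ r')); last first.
  by apply: ncomp_links; apply: links_in_sub => p; rewrite !mem_cat orbC.
apply: (@ncomp_equiv _ _ _ _ (fun x : I + void =>
  match x with inl i => i | inr u => match u with end end) inl).
- by move=> _ _ /mapP[[x y] xy [-> ->]]; apply: linked_edge.
- by move=> x y /(mem_map_edge (@inl I void))/linked_edge.
- by case=> // i; rewrite /linked connect0.
by move=> i; rewrite /linked connect0.
Qed.
End TangleSkein.

Section TangleMoves.
Local Open Scope ring_scope.
Variables (X : finType) (Q : psyquandle X) (R : comPzRingType) (beta : bracket Q R).
Notation d := (bd beta).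

Definition tangle_colors (I : finType) (T : tangle I) :=
  {ffun (I + inner T) -> X}.

Definition tangle_coloring (I : finType) (T : tangle I) (f : tangle_colors T) : bool :=
  all (crossing_rule Q f) (tcrossings T) && all (fun j => f j.1 == f j.2) (tjoints T).

Definition agree (I J J' : finType) (f : {ffun (I + J) -> X}) (f' : {ffun (I + J') -> X}) :=
  [forall i, f (inl i) == f' (inl i)].

Definition tangle_skein (I : finType) (T : tangle I) (f : tangle_colors T)
    (r : seq (I * I)) : R :=
  skein d [seq skein_node beta f c | c <- tcrossings T]
    (map (map_edge inl) r ++ tjoints T).

Definition simulates (I : finType) (T T' : tangle I) : Prop :=
  forall f : tangle_colors T, tangle_coloring f ->
  exists2 f' : tangle_colors T', tangle_coloring f' &
    agree f f' /\ forall r, tangle_skein f r = tangle_skein f' r.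

(** The ends determine the colours inside the disk, so that colourings are not
    counted twice when they are compared outside. *)
Definition rigid (I : finType) (T : tangle I) : Prop :=
  forall f f' : tangle_colors T, tangle_coloring f -> tangle_coloring f' ->
  agree f f' -> f = f'.

Lemma glue_coloring (K : piece) (T : tangle (edge K)) (f : tangle_colors T) :
  is_coloring Q (f : {ffun edge (glue T) -> X}) =
  is_coloring Q [ffun e => f (inl e)] && tangle_coloring f.
Proof.
rewrite /is_coloring /tangle_coloring /= !all_cat !all_map.
rewrite (eq_all (a2 := crossing_rule Q [ffun e => f (inl e)])); last first.
  by move=> c /=; apply: (crossing_rule_map Q (f := [ffun e => f (inl e)])) => e;
     rewrite ffunE.
rewrite [X in _ && (X && _)](eq_all (a2 := fun j => [ffun e => f (inl e)] j.1
   == [ffun e => f (inl e)] j.2)); last by move=> j; rewrite /= !ffunE.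
by rewrite andbACA.
Qed.

Lemma Phi_glue (K : piece) (T T' : tangle (edge K)) :
    simulates T T' -> simulates T' T -> rigid T -> rigid T' ->
  Phi beta (glue T) = Phi beta (glue T').
Proof.
move=> sim sim' rig rig'.
have agree_sym (T1 T2 : tangle (edge K)) (f1 : tangle_colors T1) (f2 : tangle_colors T2) :
    agree f1 f2 -> agree f2 f1.
  by move=> /forallP ag; apply/forallP => i; rewrite eq_sym.
have agree_out (T1 T2 : tangle (edge K)) (f1 : tangle_colors T1) (f2 : tangle_colors T2) :
    agree f1 f2 -> [ffun e => f1 (inl e)] = [ffun e => f2 (inl e)] :> {ffun edge K -> X}.
  by move=> /forallP ag; apply/ffunP => e; rewrite !ffunE; apply/eqP.
have agree_trans (T1 T2 T3 : tangle (edge K)) (f1 : tangle_colors T1)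
    (f2 : tangle_colors T2) (f3 : tangle_colors T3) :
    agree f1 f2 -> agree f2 f3 -> agree f1 f3.
  by move=> /forallP a /forallP b; apply/forallP => i; rewrite (eqP (a i)).
apply: (@Phi_eq _ _ _ _ (glue T) (glue T') (@agree _ _ _)).
- move=> f; rewrite glue_coloring => /andP[fK /sim[f' f'T' [ag _]]].
  by exists f' => //; rewrite glue_coloring -(agree_out _ _ _ _ ag) fK.
- move=> f; rewrite glue_coloring => /andP[fK /sim'[f' f'T' [ag _]]].
  exists f'; last exact: agree_sym.
  by rewrite glue_coloring -(agree_out _ _ _ _ ag) fK.
- move=> f f1 f2; rewrite !glue_coloring => /andP[_ c1] /andP[_ c2] a1 a2.
  by apply: rig' => //; apply: agree_trans (agree_sym _ _ _ _ a1) a2.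
- move=> f1 f2 f; rewrite !glue_coloring => /andP[_ c1] /andP[_ c2] a1 a2.
  by apply: rig => //; apply: agree_trans a1 (agree_sym _ _ _ _ a2).
move=> f f'; rewrite !glue_coloring => /andP[_ c] /andP[_ c'] ag.
have [f1 c1 [ag1 eq1]] := sim _ c.
have ? : f1 = f' by apply: rig' => //; apply: agree_trans (agree_sym _ _ _ _ ag1) ag.
subst f1; rewrite !state_sum_skein /= !map_cat -!map_comp.
pose g : edge K -> X := fun e => f (inl e).
pose ns := [seq skein_node beta g c | c <- crossings K].
transitivity (skein d ([seq (map_ends inl n.1, n.2) | n <- ns] ++
    [seq skein_node beta f c | c <- tcrossings T])
    (map (map_edge inl) (joints K) ++ tjoints T)).
  congr (skein _ (_ ++ _) _); rewrite -map_comp; apply: eq_map => x.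
  by rewrite /skein_node /= !(@weight_map _ _ _ _ _ _ g f).
have := @skein_cat_eq R d _ _ _ inl inl ns _ _ (tjoints T) (tjoints T') eq1 (joints K).
move=> ->.
congr (skein _ (_ ++ _) _); rewrite -map_comp; apply: eq_map => x.
by rewrite /skein_node /= !(@weight_map _ _ _ _ _ _ g f') // => e;
   rewrite /g (eqP (forallP ag e)).
Qed.
End TangleMoves.

(** * Invariance under the moves *)

Section Moves.
Local Open Scope ring_scope.
Variables (X : finType) (Q : psyquandle X) (R : comPzRingType) (beta : bracket Q R).
Notation d := (bd beta).

Lemma crossing_rule_xc (E : Type) (f : E -> X) k ru rv ul uu vl vu :
  crossing_rule Q f (xc k ru rv ul uu vl vu) =
  adm (xc_node beta k ru rv) (f ul) (f vl) (f uu) (f vu).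
Proof. by case: ru rv k => [] [] []. Qed.

Lemma skein_xc (E : finType) (f : E -> X) k ru rv ul uu vl vu ns r :
  skein d (skein_node beta f (xc k ru rv ul uu vl vu) :: ns) r =
  skein d (((ul, vl, uu, vu),
            coefs (xc_node beta k ru rv) (f ul) (f vl) (f uu) (f vu)) :: ns) r.
Proof.
case: ru rv => [] []; rewrite /coefs.
- by rewrite [RHS]skein_turn [RHS]skein_turn; case: k.
- by rewrite [RHS]skein_turn; case: k.
- by rewrite [RHS]skein_turn [RHS]skein_turn [RHS]skein_turn; case: k.
- by case: k.
Qed.

(** The data of [xc] as a tuple, in order to rewrite all nodes of a picture at
    once. *)
Definition xc_of (E : Type) (x : ckind * bool * bool * ends E) : crossing E :=
  let: (k, ru, rv, (ul, vl, uu, vu)) := x in xc k ru rv ul uu vl vu.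

Definition xc_skein_node (E : Type) (f : E -> X) (x : ckind * bool * bool * ends E) :
    ends E * (R * R) :=
  let: (k, ru, rv, (ul, vl, uu, vu)) := x in
  ((ul, vl, uu, vu), coefs (xc_node beta k ru rv) (f ul) (f vl) (f uu) (f vu)).

Lemma skein_xcs (E : finType) (f : E -> X) xs r :
  skein d [seq skein_node beta f (xc_of x) | x <- xs] r =
  skein d [seq xc_skein_node f x | x <- xs] r.
Proof.
elim: xs r => [//|[[[k ru] rv] [[[ul vl] uu] vu]] xs IHxs] r.
by rewrite [LHS]skein_xc /= !IHxs.
Qed.

Definition same_tangle (I : finType) (T T' : tangle I) : Prop :=
  [/\ simulates beta T T', simulates beta T' T, rigid Q T & rigid Q T'].

Variable I : finType.

Section Triangles.
Variables (k12 k13 k23 : ckind) (r1 r2 r3 : bool) (s1 t1 s2 t2 s3 t3 : I).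
Let N12 := xc_node beta k12 r1 r2.
Let N13 := xc_node beta k13 r1 r3.
Let N23 := xc_node beta k23 r2 r3.
Let T := triangle k12 k13 k23 r1 r2 r3 s1 t1 s2 t2 s3 t3.
Let T' := triangle' k12 k13 k23 r1 r2 r3 s1 t1 s2 t2 s3 t3.
Let m1 : I + 'I_3 := inr (@Ordinal 3 0 isT).
Let m2 : I + 'I_3 := inr (@Ordinal 3 1 isT).
Let m3 : I + 'I_3 := inr (@Ordinal 3 2 isT).

Lemma triangle_coloring (f : {ffun I + 'I_3 -> X}) :
  tangle_coloring Q (f : tangle_colors X T) =
  [&& adm N12 (f (inl s1)) (f (inl s2)) (f m1) (f m2),
      adm N13 (f m1) (f (inl s3)) (f (inl t1)) (f m3)
    & adm N23 (f m2) (f m3) (f (inl t2)) (f (inl t3))].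
Proof. by rewrite /tangle_coloring /= !crossing_rule_xc !andbT. Qed.

Lemma triangle'_coloring (f : {ffun I + 'I_3 -> X}) :
  tangle_coloring Q (f : tangle_colors X T') =
  [&& adm N23 (f (inl s2)) (f (inl s3)) (f m2) (f m3),
      adm N13 (f (inl s1)) (f m3) (f m1) (f (inl t3))
    & adm N12 (f m1) (f m2) (f (inl t1)) (f (inl t2))].
Proof. by rewrite /tangle_coloring /= !crossing_rule_xc !andbT. Qed.

Lemma ffun3_eq (f f' : {ffun I + 'I_3 -> X}) : agree f f' ->
  f m1 = f' m1 -> f m2 = f' m2 -> f m3 = f' m3 -> f = f'.
Proof.
move=> /forallP ag e1 e2 e3; apply/ffunP => -[i|[[|[|[|//]]] lt]].
- exact/eqP.
- by rewrite (_ : inr _ = m1) //; congr inr; apply: val_inj.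
- by rewrite (_ : inr _ = m2) //; congr inr; apply: val_inj.
by rewrite (_ : inr _ = m3) //; congr inr; apply: val_inj.
Qed.

Lemma triangle_skeinE (f f' : {ffun I + 'I_3 -> X}) r : agree f f' ->
    triangle_eq d
      (coefs N12 (f (inl s1)) (f (inl s2)) (f m1) (f m2))
      (coefs N13 (f m1) (f (inl s3)) (f (inl t1)) (f m3))
      (coefs N23 (f m2) (f m3) (f (inl t2)) (f (inl t3)))
      (coefs N12 (f' m1) (f' m2) (f' (inl t1)) (f' (inl t2)))
      (coefs N13 (f' (inl s1)) (f' m3) (f' m1) (f' (inl t3)))
      (coefs N23 (f' (inl s2)) (f' (inl s3)) (f' m2) (f' m3)) ->
  tangle_skein beta (f : tangle_colors X T) r =
  tangle_skein beta (f' : tangle_colors X T') r.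
Proof.
move=> ag eqT; rewrite /tangle_skein !cats0.
have eqL := skein_xcs f [:: (k12, r1, r2, (inl s1, inl s2, m1, m2));
  (k13, r1, r3, (m1, inl s3, inl t1, m3)); (k23, r2, r3, (m2, m3, inl t2, inl t3))].
have eqR := skein_xcs f' [:: (k23, r2, r3, (inl s2, inl s3, m2, m3));
  (k13, r1, r3, (inl s1, m3, m1, inl t3)); (k12, r1, r2, (m1, m2, inl t1, inl t2))].
rewrite [LHS]eqL [RHS]eqR; exact: triangle_skein.
Qed.

Lemma same_triangle : hexagon d N12 N13 N23 -> same_tangle T T'.
Proof.
move=> hex.
have [[_ un12] _ _ _] : determined N12 by exact: xc_node_determined.
have [[_ un13] _ _ _] : determined N13 by exact: xc_node_determined.
have [[_ un23] _ _ _] : determined N23 by exact: xc_node_determined.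
have agP (f f' : {ffun I + 'I_3 -> X}) : agree f f' -> forall i, f (inl i) = f' (inl i).
  by move=> /forallP ag i; apply/eqP.
split.
- move=> f; rewrite triangle_coloring => /and3P[c12 c13 c23].
  have [u1 [u2 [u3 [l1 [l2 [l3 [n1 [n2 [n3 [[a1 a2 a3] [[b1 b2 b3] eqT]]]]]]]]]]] :=
    hex (f (inl s1)) (f (inl s2)) (f (inl s3)).
  have [? ?] := un12 _ _ _ _ _ _ c12 a1; subst l1 l2.
  have [? ?] := un13 _ _ _ _ _ _ c13 a2; subst u1 l3.
  have [? ?] := un23 _ _ _ _ _ _ c23 a3; subst u2 u3.
  pose f' : {ffun I + 'I_3 -> X} :=
    [ffun x : I + 'I_3 => match x with inl i => f (inl i)
                                    | inr j => nth n1 [:: n1; n2; n3] j end].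
  have ag : agree f f' by apply/forallP => i; rewrite ffunE.
  exists f'; first by rewrite triangle'_coloring !ffunE; apply/and3P.
  split=> [|r]; first exact: ag.
  by apply: (triangle_skeinE r ag); rewrite !ffunE.
- move=> f'; rewrite triangle'_coloring => /and3P[c23 c13 c12].
  have [u1 [u2 [u3 [l1 [l2 [l3 [n1 [n2 [n3 [[a1 a2 a3] [[b1 b2 b3] eqT]]]]]]]]]]] :=
    hex (f' (inl s1)) (f' (inl s2)) (f' (inl s3)).
  have [? ?] := un23 _ _ _ _ _ _ c23 b1; subst n2 n3.
  have [? ?] := un13 _ _ _ _ _ _ c13 b2; subst n1 u3.
  have [? ?] := un12 _ _ _ _ _ _ c12 b3; subst u1 u2.
  pose f : {ffun I + 'I_3 -> X} :=
    [ffun x : I + 'I_3 => match x with inl i => f' (inl i)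
                                    | inr j => nth l1 [:: l1; l2; l3] j end].
  have ag : agree f f' by apply/forallP => i; rewrite ffunE.
  have ag' : agree f' f by apply/forallP => i; rewrite ffunE.
  exists f; first by rewrite triangle_coloring !ffunE; apply/and3P.
  split=> [|r]; first exact: ag'.
  by apply/esym; apply: (triangle_skeinE r ag); rewrite !ffunE.
- move=> f f'; rewrite !triangle_coloring => /and3P[c12 c13 c23] /and3P[c12' c13' c23'] ag.
  rewrite -!(agP _ _ ag) in c12' c13' c23'.
  have [e1 e2] := un12 _ _ _ _ _ _ c12 c12'; rewrite -e1 -e2 in c13' c23'.
  have [_ e3] := un13 _ _ _ _ _ _ c13 c13'.
  exact: ffun3_eq.
move=> f f'; rewrite !triangle'_coloring => /and3P[c23 c13 c12] /and3P[c23' c13' c12'] ag.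
rewrite -!(agP _ _ ag) in c12' c13' c23'.
have [e2 e3] := un23 _ _ _ _ _ _ c23 c23'; rewrite -e2 -e3 in c13' c12'.
have [e1 _] := un13 _ _ _ _ _ _ c13 c13'.
exact: ffun3_eq.
Qed.
End Triangles.

Section Bigons.
Variables (r1 r2 : bool) (s1 t1 s2 t2 : I).
Let m1 : I + 'I_2 := inr (@Ordinal 2 0 isT).
Let m2 : I + 'I_2 := inr (@Ordinal 2 1 isT).

Lemma bigon_coloring k k' (f : {ffun I + 'I_2 -> X}) :
  tangle_coloring Q (f : tangle_colors X (bigon k k' r1 r2 s1 t1 s2 t2)) =
  adm (xc_node beta k r1 r2) (f (inl s1)) (f (inl s2)) (f m1) (f m2) &&
  adm (xc_node beta k' r2 r1) (f m2) (f m1) (f (inl t2)) (f (inl t1)).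
Proof. by rewrite /tangle_coloring /= !crossing_rule_xc !andbT. Qed.

Lemma bigon_tangle_skein k k' (f : {ffun I + 'I_2 -> X}) r :
  let p := coefs (xc_node beta k r1 r2) (f (inl s1)) (f (inl s2)) (f m1) (f m2) in
  let q := coefs (xc_node beta k' r2 r1) (f m2) (f m1) (f (inl t2)) (f (inl t1)) in
  tangle_skein beta (f : tangle_colors X (bigon k k' r1 r2 s1 t1 s2 t2)) r =
  p.1 * q.1 * d ^+ ncomp ([:: (s1, t1); (s2, t2)] ++ r) +
  (p.1 * q.2 + p.2 * q.1 + d * (p.2 * q.2)) * d ^+ ncomp ([:: (s1, s2); (t1, t2)] ++ r).
Proof.
move=> p q; rewrite /tangle_skein !cats0.
have eq := skein_xcs f [:: (k, r1, r2, (inl s1, inl s2, m1, m2));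
  (k', r2, r1, (m2, m1, inl t2, inl t1))].
rewrite [LHS]eq; exact: bigon_skein.
Qed.

Lemma bigon_rigid k k' : rigid Q (bigon k k' r1 r2 s1 t1 s2 t2).
Proof.
move=> f f'; rewrite !bigon_coloring => /andP[c _] /andP[c' _] /forallP ag.
have [[_ un] _ _ _] := xc_node_determined beta k r1 r2.
rewrite -!(eqP (ag _)) in c'; have [e1 e2] := un _ _ _ _ _ _ c c'.
apply/ffunP => -[i|[[|[|//]] lt]].
- exact/eqP.
- by rewrite (_ : inr _ = m1) //; congr inr; apply: val_inj.
by rewrite (_ : inr _ = m2) //; congr inr; apply: val_inj.
Qed.

Lemma bigon_simulates k k' l l' :
    exchange d (xc_node beta k r1 r2) (xc_node beta k' r2 r1)
               (xc_node beta l r1 r2) (xc_node beta l' r2 r1) ->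
  simulates beta (bigon k k' r1 r2 s1 t1 s2 t2) (bigon l l' r1 r2 s1 t1 s2 t2).
Proof.
move=> ex f; rewrite bigon_coloring => /andP[c c'].
have [[_ un] _ _ _] := xc_node_determined beta k r1 r2.
have [[_ un'] _ _ _] := xc_node_determined beta k' r2 r1.
have [u1 [u2 [l1 [l2 [n1 [n2 [[a1 a2 a3 a4] [e1 e2]]]]]]]] := ex (f (inl s1)) (f (inl s2)).
have [? ?] := un _ _ _ _ _ _ c a1; subst l1 l2.
have [? ?] := un' _ _ _ _ _ _ c' a2; subst u1 u2.
exists [ffun x : I + 'I_2 => match x with inl i => f (inl i)
                                        | inr j => nth n1 [:: n1; n2] j end].
  by rewrite bigon_coloring !ffunE; apply/andP.
split=> [|r]; first by apply/forallP => i; rewrite ffunE.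
rewrite bigon_tangle_skein [RHS]bigon_tangle_skein !ffunE.
by rewrite e1 e2.
Qed.

Lemma same_bigon k k' l l' :
    exchange d (xc_node beta k r1 r2) (xc_node beta k' r2 r1)
               (xc_node beta l r1 r2) (xc_node beta l' r2 r1) ->
  same_tangle (bigon k k' r1 r2 s1 t1 s2 t2) (bigon l l' r1 r2 s1 t1 s2 t2).
Proof.
move=> ex; split; try exact: bigon_rigid; apply: bigon_simulates => //.
exact: exchange_sym.
Qed.

Definition fill_void (J : finType) (f : {ffun I + J -> X}) : {ffun I + void -> X} :=
  [ffun x : I + void => match x with inl i => f (inl i)
                                   | inr v => match v with end end].

Lemma agree_fill_void (J : finType) (f : {ffun I + J -> X}) : agree f (fill_void f).
Proof. by apply/forallP => i; rewrite ffunE. Qed.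

Lemma void_rigid (T : tangle I) cs js : T = @Tangle I void cs js -> rigid Q T.
Proof.
move=> -> f f' _ _ /forallP ag; apply/ffunP => -[i|[]].
by apply/eqP; apply: ag.
Qed.

Lemma two_arcs_coloring (f : {ffun I + void -> X}) :
  tangle_coloring Q (f : tangle_colors X (two_arcs r1 r2 s1 t1 s2 t2)) =
  (f (inl s1) == f (inl t1)) && (f (inl s2) == f (inl t2)).
Proof.
rewrite /tangle_coloring /= andbT /Defs.arc.
by case: r1 r2 => [] [] //=; congr (_ && _); rewrite eq_sym.
Qed.

Lemma two_arcs_skein (f : {ffun I + void -> X}) r :
  tangle_skein beta (f : tangle_colors X (two_arcs r1 r2 s1 t1 s2 t2)) r =
  d ^+ ncomp ([:: (s1, t1); (s2, t2)] ++ r).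
Proof.
have jE : map (map_edge inl) [:: Defs.arc r1 s1 t1; Defs.arc r2 s2 t2] =
    tjoints (two_arcs r1 r2 s1 t1 s2 t2).
  by rewrite /= /Defs.arc /map_edge; case: (r1); case: (r2).
rewrite /tangle_skein -jE [LHS]arcs_skein; congr (_ ^+ _).
have flip x y z t : links_in [:: Defs.arc r1 x y; Defs.arc r2 z t] [:: (x, y); (z, t)].
  move=> u v; rewrite !inE /Defs.arc => /orP[]; case: ifP => _ /eqP[-> ->];
  by [apply: linked_edge; rewrite !inE eqxx ?orbT
     |rewrite linked_sym; apply: linked_edge; rewrite !inE eqxx ?orbT].
have flip' x y z t : links_in [:: (x, y); (z, t)] [:: Defs.arc r1 x y; Defs.arc r2 z t].
  move=> u v; rewrite /Defs.arc !inE => /orP[] /eqP[-> ->];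
  [case: (r1) | case: (r2)];
  by [apply: linked_edge; rewrite !inE eqxx ?orbT
     |rewrite linked_sym; apply: linked_edge; rewrite !inE eqxx ?orbT].
have rr : links_in r r by apply: links_in_sub.
by apply: ncomp_links; apply: links_in_cat.
Qed.

Lemma same_RII k k' : inverse d (xc_node beta k r1 r2) (xc_node beta k' r2 r1) ->
  same_tangle (bigon k k' r1 r2 s1 t1 s2 t2) (two_arcs r1 r2 s1 t1 s2 t2).
Proof.
move=> inv.
have [[exN _] _ _ _] := xc_node_determined beta k r1 r2.
have [[_ un'] _ _ _] := xc_node_determined beta k' r2 r1.
have skE (f : {ffun I + 'I_2 -> X}) r :
  f (inl s1) = f (inl t1) -> f (inl s2) = f (inl t2) ->
  tangle_skein beta (f : tangle_colors X (bigon k k' r1 r2 s1 t1 s2 t2)) r =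
  d ^+ ncomp ([:: (s1, t1); (s2, t2)] ++ r).
  move=> e1 e2; rewrite bigon_tangle_skein -e1 -e2.
  have [_ []] := inv (f (inl s1)) (f (inl s2)) (f m1) (f m2).
  move: (coefs _ _ _ _ _) (coefs _ _ _ _ _) => q p c1 c2 dE.
  have h0 : p.1 * q.2 + p.2 * q.1 + d * (p.2 * q.2) = 0.
    by rewrite c2 mulr1 [X in _ + X]dE; ring.
  by rewrite c1 h0 mul1r mul0r addr0.
split.
- move=> f; rewrite bigon_coloring => /andP[c c'].
  have a' : adm (xc_node beta k' r2 r1) (f m2) (f m1) (f (inl s2)) (f (inl s1)).
    by rewrite (inv _ _ _ _).1.
  have [e2 e1] := un' _ _ _ _ _ _ a' c'.
  exists (fill_void f); first by rewrite two_arcs_coloring !ffunE e1 e2 !eqxx.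
  split=> [|r]; first exact: agree_fill_void.
  by rewrite skE // [RHS]two_arcs_skein.
- move=> f; rewrite two_arcs_coloring => /andP[/eqP e1 /eqP e2].
  have [n1 [n2 c]] := exN (f (inl s1)) (f (inl s2)).
  exists [ffun x : I + 'I_2 => match x with inl i => f (inl i)
                                          | inr j => nth n1 [:: n1; n2] j end].
    rewrite bigon_coloring !ffunE c /= -e1 -e2.
    by rewrite (inv _ _ _ _).1.
  split=> [|r]; first by apply/forallP => i; rewrite ffunE.
  by rewrite two_arcs_skein [RHS]skE // !ffunE.
- exact: bigon_rigid.
exact: void_rigid.
Qed.
End Bigons.

Lemma straight_skein (a b : I) (f : {ffun I + void -> X}) r :
  tangle_skein beta (f : tangle_colors X (straight a b)) r = d ^+ ncomp ((a, b) :: r).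
Proof. exact: (arcs_skein d r [:: (a, b)]). Qed.

Lemma same_kink (c : crossing (I + unit)) (a b : I) :
    (forall f : I + unit -> X, crossing_rule Q f c -> f (inl a) = f (inl b)) ->
    (forall x, exists m, forall f : I + unit -> X,
       f (inl a) = x -> f (inl b) = x -> f (inr tt) = m -> crossing_rule Q f c) ->
    (forall f f' : I + unit -> X, crossing_rule Q f c -> crossing_rule Q f' c ->
       f (inl a) = f' (inl a) -> f (inl b) = f' (inl b) -> f (inr tt) = f' (inr tt)) ->
    (forall (f : I + unit -> X) r, crossing_rule Q f c ->
       skein d [:: skein_node beta f c] (map (map_edge inl) r) = d ^+ ncomp ((a, b) :: r)) ->
  same_tangle (@Tangle I unit [:: c] [::]) (straight a b).
Proof.
move=> ends_eq exm unm skE.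
have colE (f : {ffun I + unit -> X}) :
  tangle_coloring Q (f : tangle_colors X (@Tangle I unit [:: c] [::])) = crossing_rule Q f c.
  by rewrite /tangle_coloring /= !andbT.
have colE' (f : {ffun I + void -> X}) :
  tangle_coloring Q (f : tangle_colors X (straight a b)) = (f (inl a) == f (inl b)).
  by rewrite /tangle_coloring /= andbT.
split.
- move=> f; rewrite colE => cf; exists (fill_void f).
    by rewrite colE' !ffunE (ends_eq _ cf).
  split=> [|r]; first exact: agree_fill_void.
  by rewrite [RHS]straight_skein /tangle_skein cats0; apply: skE.
- move=> f; rewrite colE' => /eqP eab; have [m mP] := exm (f (inl a)).
  pose f' : {ffun I + unit -> X} := [ffun x : I + unit => if x is inl i then f (inl i) else m].
  have cf : crossing_rule Q f' c by apply: mP; rewrite ffunE.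
  exists f'; first by rewrite colE.
  split=> [|r]; first by apply/forallP => i; rewrite ffunE.
  by rewrite [LHS]straight_skein /tangle_skein cats0; apply/esym; apply: skE.
- move=> f f'; rewrite !colE => cf cf' /forallP ag; apply/ffunP => -[i|[]].
    by apply/eqP; apply: ag.
  by apply: unm => //; apply/eqP; apply: ag.
exact: void_rigid.
Qed.

Lemma same_kink_left k (a b : I) : kink_node d (upward_node beta k) ->
  same_tangle (kink_left k a b) (straight a b).
Proof.
move=> [k1 k2 kE].
have [_ [_ un1] _ [_ un3]] : determined (upward_node beta k).
  exact: (xc_node_determined beta k false false).
have ruleE (f : I + unit -> X) :
    crossing_rule Q f (Crossing k (inr tt) (inl a) (inr tt) (inl b)) =
    adm (upward_node beta k) (f (inr tt)) (f (inl a)) (f (inl b)) (f (inr tt)).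
  by case: k {k1 k2 kE un1 un3}.
apply: same_kink => [f|x|f f'|f r]; rewrite ?ruleE.
- move=> c; have [x xP] := k1 (f (inr tt)).
  by have [-> ->] := un1 _ _ _ _ _ _ (c : adm (turn _) _ _ _ _) xP.
- by have [m mP] := k2 x; exists m => f; rewrite ruleE => -> -> ->.
- by move=> c c' ea eb; rewrite -ea -eb in c'; have [] := un3 _ _ _ _ _ _ c c'.
move=> c; have [x xP] := k1 (f (inr tt)).
have [ea eb] := un1 _ _ _ _ _ _ (c : adm (turn _) _ _ _ _) xP.
have := kink_skein d a b (coefs (upward_node beta k) (f (inr tt)) x x (f (inr tt))) true r.
rewrite /= (kE _ _ xP) mul1r => <-.
by congr (_ * _ + _ * _); rewrite -ea; case: k {k1 k2 kE un1 un3 ruleE c xP ea eb}.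
Qed.

Lemma same_kink_right k (a b : I) : kink_node d (upward_node beta k) ->
  same_tangle (kink_right k a b) (straight a b).
Proof.
move=> [k1 k2 kE].
have [_ [_ un1] _ [_ un3]] : determined (upward_node beta k).
  exact: (xc_node_determined beta k false false).
have ruleE (f : I + unit -> X) :
    crossing_rule Q f (Crossing k (inl a) (inr tt) (inl b) (inr tt)) =
    adm (upward_node beta k) (f (inl a)) (f (inr tt)) (f (inr tt)) (f (inl b)).
  by case: k {k1 k2 kE un1 un3}.
apply: same_kink => [f|x|f f'|f r]; rewrite ?ruleE.
- move=> c; have [x xP] := k2 (f (inr tt)).
  by have [-> ->] := un3 _ _ _ _ _ _ (c : adm (turn (turn (turn _))) _ _ _ _) xP.
- by have [m mP] := k1 x; exists m => f; rewrite ruleE => -> -> ->.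
- by move=> c c' ea eb; rewrite -ea -eb in c'; have [] := un1 _ _ _ _ _ _ c c'.
move=> c; have [x xP] := k2 (f (inr tt)).
have [eb ea] := un3 _ _ _ _ _ _ (c : adm (turn (turn (turn _))) _ _ _ _) xP.
have := kink_skein d a b (coefs (upward_node beta k) x (f (inr tt)) (f (inr tt)) x) false r.
rewrite /= (kE _ _ xP) mul1r => <-.
congr (_ * _ + _ * _); rewrite /weight /coefficient /label_pair /=;
  by case: k {k1 k2 kE un1 un3 ruleE c xP}; rewrite /= ea eb.
Qed.

Lemma same_singular (T T' : tangle I) : singular_move T T' -> same_tangle T T'.
Proof.
have kink (s : bool) : kink_node d (upward_node beta (signed s)).
  by case: s; [exact: positive_kink | exact: negative_kink].
case.
- by move=> s a b; apply: same_kink_left.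
- by move=> s a b; apply: same_kink_right.
- by move=> o r1 r2 s1 t1 s2 t2; apply: same_RII; apply: xc_node_inverse.
- move=> h1 h2 h3 r1 r2 r3 s1 t1 s2 t2 s3 t3 uniq_h /=.
  apply: same_triangle; apply: xc_node_RIII; move: uniq_h; rewrite /= !inE; lia.
- by move=> s r1 r2 s1 t1 s2 t2; apply: same_bigon; apply: xc_node_pII.
by move=> o r1 r2 r3 s1 t1 s2 t2 s3 t3; apply: same_triangle; apply: xc_node_pIII.
Qed.

Lemma same_pseudo (T T' : tangle I) : pI_adequate Q -> pI_adequate_bracket beta ->
  pseudo_move T T' -> same_tangle T T'.
Proof.
move=> adQ adb; case.
- exact: same_singular.
- by move=> a b; apply: same_kink_left; apply: vertex_kink.
by move=> a b; apply: same_kink_right; apply: vertex_kink.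
Qed.

End Moves.

Section Invariance.
Variables (X : finType) (Q : psyquandle X) (R : comPzRingType) (beta : bracket Q R).

Lemma Phi_planar_isotopy (D D' : diagram) :
  planar_isotopy D D' -> Phi beta D = Phi beta D'.
Proof.
by case=> [/Phi_iso //|[e /Phi_iso <-]]; rewrite Phi_subdivide.
Qed.

Lemma Phi_local_move (M : forall I : finType, tangle I -> tangle I -> Prop) :
    (forall I (T T' : tangle I), M I T T' -> same_tangle beta T T') ->
  forall D D' : diagram, local_move M D D' -> Phi beta D = Phi beta D'.
Proof.
move=> sameM D D' [K [T [T' [/sameM[sim sim' rig rig'] isoD isoD']]]].
by rewrite -(Phi_iso beta isoD) -(Phi_iso beta isoD'); apply: Phi_glue.
Qed.

Lemma Phi_clos (M : diagram -> diagram -> Prop) :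
    (forall D D', M D D' -> Phi beta D = Phi beta D') ->
  forall D D', Relation_Operators.clos_refl_sym_trans diagram M D D' ->
  Phi beta D = Phi beta D'.
Proof. by move=> inv D D'; elim=> // x y z _ -> _ ->. Qed.
End Invariance.

Theorem proposition1 (X : finType) (Q : psyquandle X) (R : comPzRingType)
    (beta : bracket Q R) :
  (forall D D' : diagram,
     singular_isotopic D D' -> Phi beta D = Phi beta D') /\
  (pI_adequate Q -> pI_adequate_bracket beta ->
   forall D D' : diagram,
     pseudo_isotopic D D' -> Phi beta D = Phi beta D').
Proof.
split=> [|adQ adb]; apply: Phi_clos => D D' [/Phi_planar_isotopy //|];
  apply: Phi_local_move => I T T'; first exact: same_singular.
exact: same_pseudo.
Qed.
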